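(* Let $G_F$ be the Farey graph, viewed as a structure in the language $L=\{E\}$ of graphs. Then the complete theory $\mathrm{Th}(G_F)$ is axiomatized by the axioms of (simple, undirected, loopless) graphs together with: (1) every edge is contained in exactly two triangles; and (2) every finite subgraph has a removable vertex. Moreover, $\mathrm{Th}(G_F)$ is $\omega$-stable of Morley rank $\omega$.
   Context: The Farey graph is defined as follows. The level-$1$ Farey graph $F_1$ consists of a single black edge contained in two triangles whose other two sides are blue edges (so $F_1$ has $4$ vertices and $5$ edges). Inductively, $F_{n+1}$ is obtained from $F_n$ by adding, for every blue edge $e$ of $F_n$, a new vertex $v_e$ joined precisely to the two end vertices of $e$ by two blue edges, and then colouring all edges of $F_n\subseteq F_{n+1}$ black. The Farey graph $G_F=\bigcup_{n\in\mathbb N}F_n$ is the union of all $F_n$, forgetting the edge colours. Subgraphs are induced subgraphs. For a graph $A$ and a vertex $x\in A$, $\mathrm{val}(x)$ is the number of neighbours of $x$ in $A$; $x$ is removable from $A$ if $\mathrm{val}(x)\le 1$, or $\mathrm{val}(x)=2$ and the two neighbours of $x$ are adjacent.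
   Formalization: The axiom that every vertex has a neighbour is added to the graph axioms with (1) and (2), since an edgeless graph satisfies those without being elementarily equivalent to G_F; ''finite subgraph'' in (2) is read as non-empty finite subgraph. *)

(* Defs.v *)
From HB Require Import structures.
From mathcomp Require Import all_boot.
From mathcomp Require Import mathcomp_extra boolp classical_sets functions.
From mathcomp Require Import cardinality.

Set Implicit Arguments.
Unset Strict Implicit.
Unset Printing Implicit Defensive.

Local Open Scope classical_set_scope.

(** [form C] is the type of formulas of the language {E} expanded by a constant
    symbol for every element of [C]; the formulas of {E} itself are [form void].
    The variables are x_0, x_1, ... *)

Inductive term (C : Type) : Type :=
| Var of nat
| Cst of C.

Inductive form (C : Type) : Type :=
| Fal
| Eq of term C & term C
| Adj of term C & term C
| Imp of form C & form C
| All of nat & form C.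

Arguments Var {C}.
Arguments Fal {C}.

Section Connectives.
Variable C : Type.
Implicit Types p q : form C.

Definition Neg p := Imp p Fal.
Definition Top : form C := Neg Fal.
Definition And p q := Neg (Imp p (Neg q)).
Definition Or p q := Imp (Neg p) q.
Definition Ex x p := Neg (All x (Neg p)).

(** [Alls n p] is "for all x_0, ..., x_{n-1}, p". *)
Fixpoint Alls n p := if n is m.+1 then Alls m (All m p) else p.

Definition tvars (t : term C) : seq nat := if t is Var x then [:: x] else [::].

Fixpoint fvars p : seq nat :=
  match p with
  | Fal => [::]
  | Eq s t | Adj s t => tvars s ++ tvars t
  | Imp p q => fvars p ++ fvars q
  | All x p => [seq y <- fvars p | y != x]
  end.

Definition in_vars n p : bool := all (fun x => x < n) (fvars p).

End Connectives.

Arguments Top {C}.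
Arguments And {C}.
Arguments Or {C}.

Record structure := Structure {
  carrier :> Type;
  edge : carrier -> carrier -> Prop;
  structure_nonempty : inhabited carrier }.

Definition upd (M : Type) (v : nat -> M) (x : nat) (a : M) : nat -> M :=
  fun y => if y == x then a else v y.

Section Satisfaction.
Variables (M : structure) (C : Type) (k : C -> M).

Definition eval (v : nat -> M) (t : term C) : M :=
  match t with Var x => v x | Cst c => k c end.

Fixpoint sat (v : nat -> M) (p : form C) : Prop :=
  match p with
  | Fal => False
  | Eq s t => eval v s = eval v t
  | Adj s t => edge (eval v s) (eval v t)
  | Imp p q => sat v p -> sat v q
  | All x p => forall a : M, sat (upd v x a) p
  end.

End Satisfaction.

Definition sentence (p : form void) : bool := in_vars 0 p.

Definition holds (M : structure) (p : form void) : Prop :=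
  forall v : nat -> M, sat (@of_void M) v p.

Definition model (M : structure) (T : set (form void)) : Prop :=
  forall p, T p -> holds M p.

Definition entails (T : set (form void)) (p : form void) : Prop :=
  forall M : structure, model M T -> holds M p.

Definition Th (M : structure) : set (form void) :=
  [set p | sentence p /\ holds M p].

Definition axiomatizes (S T : set (form void)) : Prop :=
  (forall p, S p -> sentence p) /\
  (forall p, sentence p -> (T p <-> entails S p)).

(** The formulas over a parameter set [A] are [form {a | A a}]. *)

Definition finitely_satisfiable (M : structure) (A : set M)
    (p : set (form {a | A a})) : Prop :=
  forall q : set (form {a | A a}), finite_set q -> q `<=` p ->
  exists v : nat -> M, forall f, q f -> sat (@proj1_sig M A) v f.

Definition complete_type (M : structure) (A : set M) (n : nat)
    (p : set (form {a | A a})) : Prop :=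
  [/\ forall f, p f -> in_vars n f,
      finitely_satisfiable p &
      forall f, in_vars n f -> p f \/ p (Neg f)].

Definition omega_stable (T : set (form void)) : Prop :=
  forall M : structure, model M T ->
  forall (A : set M) (n : nat), countable A ->
  countable [set p | @complete_type M A n p].

Definition omega_saturated (M : structure) : Prop :=
  forall (A : set M) (n : nat) (p : set (form {a | A a})),
  finite_set A -> complete_type n p ->
  exists v : nat -> M, forall f, p f -> sat (@proj1_sig M A) v f.

(** Countable ordinals; [OLim f] is the supremum of the [f i]. *)
Inductive ord : Type :=
| OZero
| OSucc of ord
| OLim of (nat -> ord).

Definition ord_omega : ord := OLim (fun i => iter i OSucc OZero).

(** [rank_ge M n a p]: the Morley rank of [p], computed in [M], is at least [a],
    where [p] is a formula with parameters from [M] in the variables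
    x_0, ..., x_{n-1}. *)
Fixpoint rank_ge (M : structure) (n : nat) (a : ord) (p : form M) : Prop :=
  match a with
  | OZero => exists v : nat -> M, sat id v p
  | OSucc b => exists q : nat -> form M,
      [/\ forall i, in_vars n (q i) /\ rank_ge n b (q i),
          forall i v, sat id v (q i) -> sat id v p &
          forall i j v, i <> j -> ~ (sat id v (q i) /\ sat id v (q j))]
  | OLim f => forall i, rank_ge n (f i) p
  end.

(** The Morley rank of a theory is that of the formula x = x. Morley rank is
    computed in omega-saturated models, of which it does not depend on the
    choice; the first conjunct excludes vacuity of the second. *)
Definition has_morley_rank (T : set (form void)) (a : ord) : Prop :=
  (exists M : structure, model M T /\ omega_saturated M) /\
  (forall M : structure, model M T -> omega_saturated M ->
     let x_eq_x := Eq (Var 0) (Var 0) : form M in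
     rank_ge 1 a x_eq_x /\ ~ rank_ge 1 (OSucc a) x_eq_x).

(** Names for vertices: the four vertices of the level-1 graph, and the vertex
    added for an edge {u, w}. *)
Inductive vertex : Type :=
| Base of 'I_4
| Apex of vertex & vertex.

HB.instance Definition _ := gen_eqMixin vertex.

(** Each edge is listed once, as a pair in an arbitrary orientation. *)
Record coloured_graph := ColouredGraph {
  black : seq (vertex * vertex);
  blue : seq (vertex * vertex) }.

Definition all_edges (F : coloured_graph) := black F ++ blue F.

Definition vertices (F : coloured_graph) : seq vertex :=
  unzip1 (all_edges F) ++ unzip2 (all_edges F).

Definition farey_level1 : coloured_graph :=
  let b i : vertex := Base (inord i) in
  {| black := [:: (b 0, b 1)];
     blue := [:: (b 0, b 2); (b 1, b 2); (b 0, b 3); (b 1, b 3)] |}.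

Definition farey_step (F : coloured_graph) : coloured_graph :=
  {| black := all_edges F;
     blue := flatten
       [seq [:: (e.1, Apex e.1 e.2); (e.2, Apex e.1 e.2)] | e <- blue F] |}.

(** The levels are numbered from 1: [farey_level n] is the graph F_{n+1}. *)
Definition farey_level (n : nat) : coloured_graph :=
  iter n farey_step farey_level1.

Definition farey_vertex : Type :=
  {u : vertex | exists n, u \in vertices (farey_level n)}.

Definition farey_edge (u w : farey_vertex) : Prop :=
  exists n, (sval u, sval w) \in all_edges (farey_level n) \/
            (sval w, sval u) \in all_edges (farey_level n).

Lemma farey_vertex_inhabited : inhabited farey_vertex.
Proof.
by split; exists (Base (inord 0)); exists 0; rewrite inE eqxx.
Qed.

Definition farey_graph : structure :=
  @Structure farey_vertex farey_edge farey_vertex_inhabited.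

Notation x_ i := (Var i : term void).

Definition ax_irreflexive : form void := All 0 (Neg (Adj (x_ 0) (x_ 0))).

Definition ax_symmetric : form void :=
  All 0 (All 1 (Imp (Adj (x_ 0) (x_ 1)) (Adj (x_ 1) (x_ 0)))).

(** No vertex is isolated. This does not follow from the other axioms, all of
    which hold in an edgeless graph. *)
Definition ax_no_isolated : form void := All 0 (Ex 1 (Adj (x_ 0) (x_ 1))).

Definition apex_of_01 i : form void :=
  And (Adj (x_ 0) (x_ i)) (Adj (x_ 1) (x_ i)).

Definition exactly_two_apices : form void :=
  Ex 2 (Ex 3 (And (Neg (Eq (x_ 2) (x_ 3)))
    (And (And (apex_of_01 2) (apex_of_01 3))
         (All 4 (Imp (apex_of_01 4)
            (Or (Eq (x_ 4) (x_ 2)) (Eq (x_ 4) (x_ 3)))))))).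

Definition ax_two_triangles : form void :=
  All 0 (All 1 (Imp (Adj (x_ 0) (x_ 1)) exactly_two_apices)).

Definition distinct_form n : form void :=
  \big[And/Top]_(i < n) \big[And/Top]_(j < i) Neg (Eq (x_ i) (x_ j)).

Definition removable_form n (i : nat) : form void :=
  Or (\big[And/Top]_(j < n) \big[And/Top]_(k < j)
        Neg (And (Adj (x_ i) (x_ j)) (Adj (x_ i) (x_ k))))
     (\big[Or/Fal]_(j < n) \big[Or/Fal]_(k < j)
        And (And (And (Adj (x_ i) (x_ j)) (Adj (x_ i) (x_ k)))
                 (Adj (x_ j) (x_ k)))
            (\big[And/Top]_(l < n | (l != j :> nat) && (l != k :> nat))
               Neg (Adj (x_ i) (x_ l)))).

Definition ax_removable n : form void :=
  Alls n (Imp (distinct_form n) (\big[Or/Fal]_(i < n) removable_form n i)).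

(** The empty subgraph has no removable vertex and is excluded. *)
Definition farey_axioms : set (form void) :=
  [set ax_irreflexive; ax_symmetric; ax_no_isolated; ax_two_triangles]
  `|` [set ax_removable n.+1 | n in setT].

Section Meaning.
Variable M : structure.
Implicit Types (A : set M) (x y z : M).

Definition simple_graph : Prop :=
  (forall x, ~ edge x x) /\ (forall x y, edge x y -> edge y x).

Definition no_isolated_vertex : Prop := forall x, exists y, edge x y.

Definition edges_in_two_triangles : Prop :=
  forall x y, edge x y -> exists z1 z2, z1 <> z2 /\
    [set z | edge x z /\ edge y z] = [set z1; z2].

Definition neighbours A x : set M := [set y | A y /\ edge x y].

Definition removable A x : Prop :=
  (forall y z, neighbours A x y -> neighbours A x z -> y = z) \/
  (exists y z, [/\ y <> z, neighbours A x = [set y; z] & edge y z]).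

Definition finite_subgraphs_removable : Prop :=
  forall A, finite_set A -> A !=set0 -> exists2 x, A x & removable A x.

Lemma satN C (k : C -> M) v p : sat k v (Neg p) <-> ~ sat k v p.
Proof. by []. Qed.

Lemma satA C (k : C -> M) v p q : sat k v (And p q) <-> sat k v p /\ sat k v q.
Proof.
split=> [h|[hp hq] /=]; last by apply.
by split; apply: contrapT => n; apply: h => /= hp hq; apply: n.
Qed.

Lemma satO C (k : C -> M) v p q : sat k v (Or p q) <-> sat k v p \/ sat k v q.
Proof.
split=> [h|[]//=].
by have [hp|hp] := pselect (sat k v p); [left|right; apply: h].
Qed.

Lemma satE C (k : C -> M) v i p :
  sat k v (Ex i p) <-> exists a, sat k (upd v i a) p.
Proof.
split=> [h|[a ha] /= h]; last exact: (h a).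
by apply: contrapT => n; apply: h => a ha; apply: n; exists a.
Qed.

Lemma sat_bigA C (k : C -> M) v n (P : pred 'I_n) (F : 'I_n -> form C) :
  sat k v (\big[And/Top]_(i < n | P i) F i) <-> forall i, P i -> sat k v (F i).
Proof.
have h (r : seq 'I_n) : sat k v (\big[And/Top]_(i <- r | P i) F i) <->
    forall i, i \in r -> P i -> sat k v (F i).
  elim: r => [|a r IH]; first by rewrite big_nil; split=> [_ i|_ []].
  rewrite big_cons; case: ifP => Pa.
    rewrite satA IH; split=> [[ha hr] i|h].
      by rewrite inE => /orP[/eqP->|/hr].
    by split=> [|i ir]; apply: h; rewrite ?inE ?eqxx ?ir ?orbT.
  rewrite IH; split=> h i ir; last by apply: h; rewrite inE ir orbT.
  by move: ir; rewrite inE => /orP[/eqP->|/h]; rewrite ?Pa.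
by rewrite h; split=> H i; [apply: H; rewrite mem_index_enum|move=> _; apply: H].
Qed.

Lemma sat_bigO C (k : C -> M) v n (F : 'I_n -> form C) :
  sat k v (\big[Or/Fal]_(i < n) F i) <-> exists i, sat k v (F i).
Proof.
have h (r : seq 'I_n) : sat k v (\big[Or/Fal]_(i <- r) F i) <->
    exists2 i, i \in r & sat k v (F i).
  elim: r => [|a r IH]; first by rewrite big_nil; split=> // -[].
  rewrite big_cons satO IH; split=> [[ha|[i ir hi]]|[i]].
  - by exists a => //; rewrite inE eqxx.
  - by exists i => //; rewrite inE ir orbT.
  - by rewrite inE => /orP[/eqP->|ir hi]; [left|right; exists i].
rewrite h; split=> [[i _ hi]|[i hi]]; exists i => //.
by rewrite mem_index_enum.
Qed.

Lemma holds_Alls n p : holds M (Alls n p) <-> holds M p.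
Proof.
elim: n p => //= n IH p; rewrite IH; split=> h v; last by move=> a; exact: h.
have := h v (v n); congr (sat _ _ _); apply/funext => y.
by rewrite /upd; case: eqP => [->|].
Qed.

Lemma sat_distinct n v : sat (@of_void M) v (distinct_form n) <->
  {in `I_n &, injective v}.
Proof.
rewrite sat_bigA; split=> [h i j|h i _].
  wlog ji : i j / j < i => [W|].
    have [ji|ij|//] := ltngtP j i; first exact: W.
    by move=> iI jI e; apply/esym; apply: W.
  rewrite !inE /= => iI jI e; exfalso.
  by have /sat_bigA/(_ (Ordinal ji) isT) := h (Ordinal iI) isT; apply.
apply/sat_bigA => j _ /= e.
have /h : (i : nat) \in `I_n by rewrite inE /= ltn_ord.
move=> /(_ j); rewrite !inE /= => /(_ (ltn_trans (ltn_ord j) (ltn_ord i)) e).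
by move=> ij; have := ltn_ord j; rewrite -ij ltnn.
Qed.

Lemma sat_removable n v i : simple_graph -> {in `I_n &, injective v} ->
  sat (@of_void M) v (removable_form n i) <-> removable (v @` `I_n) (v i).
Proof.
move=> [_ sym] vI.
have inj j l : j < n -> l < n -> v j = v l -> j = l.
  by move=> jn ln; apply: vI; rewrite inE.
rewrite satO; split=> [[/sat_bigA h|/sat_bigO[j /sat_bigO[l]]]|[h|]].
- left=> _ _ [[j jn <-] ej] [[l ln <-] el]; congr v.
  wlog lj : j l jn ln ej el / l < j => [W|].
    by case: (ltngtP l j) => // lt; [|apply/esym]; apply: W.
  have /sat_bigA/(_ (Ordinal lj) isT) := h (Ordinal jn) isT.
  by move=> /satN[]; apply/satA.
- move=> /satA[/satA[/satA[/= ej el] ejl] /sat_bigA h].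
  have ln : l < n := ltn_trans (ltn_ord l) (ltn_ord j).
  right; exists (v j), (v l); split=> //.
    move=> /(inj _ _ (ltn_ord j) ln) jl.
    by have := ltn_ord l; rewrite -jl ltnn.
  apply/seteqP; split=> [_ [[m mn <-] em]|_ [->|->]]; last 2 first.
  + by split=> //; exists j => //=; apply: ltn_ord.
  + by split=> //; exists l.
  have [mj|mj] := eqVneq m j; first by rewrite mj; left.
  have [ml|ml] := eqVneq m l; first by rewrite ml; right.
  by case: (h (Ordinal mn)); rewrite //= mj ml.
- left; apply/sat_bigA => j _; apply/sat_bigA => l _; apply/satN => /satA[ej el].
  have ln : l < n := ltn_trans (ltn_ord l) (ltn_ord j).
  have /(inj _ _ (ltn_ord j) ln) jl : v j = v l.
    apply: h; first by split=> //; exists j => //=; apply: ltn_ord.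
    by split=> //; exists l.
  by have := ltn_ord l; rewrite -jl ltnn.
- move=> [y [z [yz nb eyz]]]; right.
  have [[j jn jy] ej] : neighbours (v @` `I_n) (v i) y by rewrite nb; left.
  have [[l ln lz] el] : neighbours (v @` `I_n) (v i) z by rewrite nb; right.
  wlog lj : y z yz nb eyz j jn jy ej l ln lz el / l < j => [W|].
    have [lt|lt|jl] := ltngtP l j; first exact: (W y z yz nb eyz j _ _ _ l).
    + apply: (W z y _ _ _ l _ _ _ j) => //.
        exact/nesym.
        by rewrite setUC.
        exact: sym.
    + by case: yz; rewrite -jy -lz jl.
  apply/sat_bigO; exists (Ordinal jn); apply/sat_bigO; exists (Ordinal lj).
  apply/satA; split.
    by apply/satA; split; [apply/satA; split|]; rewrite /= ?jy ?lz.
  apply/sat_bigA => m /andP[/= mj ml] em.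
  have : neighbours (v @` `I_n) (v i) (v m).
    by split=> //; exists m => //=; apply: ltn_ord.
  rewrite nb -jy -lz => -[] /inj; rewrite ltn_ord => /(_ isT).
    by move=> /(_ jn) e; rewrite e eqxx in mj.
  by move=> /(_ ln) e; rewrite e eqxx in ml.
Qed.

Lemma model_farey_axioms : model M farey_axioms <->
  [/\ simple_graph, no_isolated_vertex, edges_in_two_triangles &
      finite_subgraphs_removable].
Proof.
have [pt] := structure_nonempty M.
have v0 : nat -> M by move=> _; exact: pt.
have Hirr : holds M ax_irreflexive <-> forall x, ~ edge x x.
  by split=> [h x|h v x]; [exact: (h v0 x)|exact: h].
have Hsym : holds M ax_symmetric <-> forall x y, edge x y -> edge y x.
  by split=> [h x y|h v x y]; [exact: (h v0 x y)|exact: h].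
have Hiso : holds M ax_no_isolated <-> no_isolated_vertex.
  split=> [h x|h v x]; last first.
    suff: sat (@of_void M) (upd v 0 x) (Ex 1 (Adj (x_ 0) (x_ 1))) by [].
    by have [y xy] := h x; apply/satE; exists y.
  have : sat (@of_void M) (upd v0 0 x) (Ex 1 (Adj (x_ 0) (x_ 1))) := h v0 x.
  by move=> /satE[y]; exists y.
have Htri : holds M ax_two_triangles <-> edges_in_two_triangles.
  split=> [h x y xy|h v x y xy].
    have : sat (@of_void M) (upd (upd v0 0 x) 1 y) exactly_two_apices.
      exact: (h v0 x y xy).
    move=> /satE[z1 /satE[z2 /satA[/satN n12 /satA[]]]].
    move=> /satA[/satA[x1 y1] /satA[x2 y2]] u.
    exists z1, z2; split=> //; apply/seteqP; split=> [z [xz yz]|z [->|->]//].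
    pose w := upd (upd (upd (upd (upd v0 0 x) 1 y) 2 z1) 3 z2) 4 z.
    have wz : sat (@of_void M) w (apex_of_01 4) by apply/satA.
    have : sat (@of_void M) w (Or (Eq (x_ 4) (x_ 2)) (Eq (x_ 4) (x_ 3))).
      exact: (u z wz).
    by move=> /satO.
  have [z1 [z2 [n12 e]]] := h x y xy.
  have [x1 y1] : [set z | edge x z /\ edge y z] z1 by rewrite e; left.
  have [x2 y2] : [set z | edge x z /\ edge y z] z2 by rewrite e; right.
  suff: sat (@of_void M) (upd (upd v 0 x) 1 y) exactly_two_apices by [].
  apply/satE; exists z1; apply/satE; exists z2.
  apply/satA; split=> //; apply/satA; split.
    by apply/satA; split; apply/satA.
  move=> z; pose w := upd (upd (upd (upd (upd v 0 x) 1 y) 2 z1) 3 z2) 4 z.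
  suff: sat (@of_void M) w (Imp (apex_of_01 4)
      (Or (Eq (x_ 4) (x_ 2)) (Eq (x_ 4) (x_ 3)))) by [].
  move=> /satA[xz yz]; apply/satO.
  by have : [set z | edge x z /\ edge y z] z by []; rewrite e.
have Hrem : simple_graph -> (forall n, holds M (ax_removable n.+1)) <->
    finite_subgraphs_removable.
  move=> sg; split=> [h A [n]|h n].
    move=> /card_set_bijP[g [gA gI gS]] [a Aa].
    have /choice[f fP] : forall i, exists x, i < n -> A x /\ g x = i.
      move=> i; have [lt|ge] := ltnP i n; last by exists pt.
      by have [x Ax gx] := gS i lt; exists x.
    have fI : {in `I_n &, injective f}.
      move=> i j; rewrite !inE /= => /fP[_ gi] /fP[_ gj] e.
      by rewrite -gi -gj e.
    have fimg : f @` `I_n = A.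
      apply/seteqP; split=> [_ [i /fP[+ _] <-] //|x Ax].
      have gx : g x < n := gA x Ax.
      exists (g x) => //; have [Af gf] := fP _ gx.
      by apply: gI; rewrite ?inE.
    have fA i : i < n -> A (f i) by move=> /fP[].
    case: n {gA gS fP} fA fI fimg => [|n] fA fI fimg.
      by move: Aa; rewrite -fimg => -[].
    have /holds_Alls/(_ f) := h n.
    move=> /(_ ((sat_distinct _ _).2 fI))/sat_bigO[i] /(sat_removable _ sg fI).
    by rewrite fimg; exists (f i) => //; apply: fA => /=; apply: ltn_ord.
  apply/holds_Alls => v /sat_distinct vI; apply/sat_bigO.
  have [||_ [i ni <-] ri] := h (v @` `I_n.+1).
  - exact/finite_image/finite_II.
  - by exists (v 0), 0.
  - by exists (Ordinal ni); apply/(sat_removable _ sg vI).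
split=> [h|[[irr sym] iso tri rem] p].
  have sg : simple_graph.
    split; [apply/Hirr|apply/Hsym]; apply: h; left; left; left; first by left.
    by right.
  split=> //.
  - by apply/Hiso; apply: h; left; left; right.
  - by apply/Htri; apply: h; left; right.
  - by apply/(Hrem sg) => n; apply: h; right; exists n.
move=> [[[[->|->]|->]|->]|[n _ <-]].
- exact/Hirr.
- exact/Hsym.
- exact/Hiso.
- exact/Htri.
- exact: (Hrem (conj irr sym)).2.
Qed.

End Meaning.

(* Main.v *)
From HB Require Import structures.
From mathcomp Require Import all_boot.
From mathcomp Require Import mathcomp_extra boolp classical_sets functions.
From mathcomp Require Import cardinality filter zify.
Require Import Defs.

(** By the removable-vertex axiom every cycle of length at least 4 has an ear, a
    vertex whose two neighbours on the cycle are adjacent. Call a set of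
    vertices strong if every path that leaves it and comes back does so at the ends of an
    edge. Strong sets are extended by one vertex in only three ways, each of
    which determines the adjacencies of the new vertex: a vertex in another
    component, a generic neighbour of a member, or a new apex of an edge. Hence
    isomorphisms between countable strong sets form a back-and-forth system
    between countably saturated models (ultrapowers), which gives completeness;
    and types over a countable strong set are coded by finite sequences of such
    extensions, which gives omega-stability.

    The rank of a vertex at finite distance from a set is the least number of
    generic neighbours needed to reach it. A formula of rank at least k contains
    a vertex not reached with fewer than k of them, since a given sequence of
    extensions has finitely many generic outcomes up to conjugacy; so a formula
    of rank at least omega contains a vertex in a new component, and two such
    formulas are never disjoint. Conversely, the ends of the walks of length k
    that turn widely at each vertex form a set of rank at least k, because such
    walks never close up. *)

Set Implicit Arguments.
Unset Strict Implicit.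
Unset Printing Implicit Defensive.

Local Open Scope classical_set_scope.

(** * Ears of cycles *)

Section Walks.
Variable M : structure.
Hypothesis HM : model M farey_axioms.
Implicit Types (A : set M) (u v x y z : M) (w : nat -> M).

Lemma edge_irr x : ~ edge x x.
Proof. by have [[irr _] _ _ _] := (model_farey_axioms M).1 HM; apply: irr. Qed.

Lemma edgeC x y : edge x y -> edge y x.
Proof. by have [[_ sym] _ _ _] := (model_farey_axioms M).1 HM; apply: sym. Qed.

Lemma edge_neq x y : edge x y -> x <> y.
Proof. by move=> + xy; rewrite xy; apply: edge_irr. Qed.

Lemma two_apices x y : edge x y -> exists z1 z2, [/\ z1 <> z2,
  edge x z1 /\ edge y z1, edge x z2 /\ edge y z2 &
  forall z, edge x z -> edge y z -> z = z1 \/ z = z2].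
Proof.
have [_ _ tri _] := (model_farey_axioms M).1 HM.
move=> /tri[z1 [z2 [n12 e]]]; exists z1, z2; split=> //.
- by have : [set z1; z2] z1 by [left]; rewrite -e.
- by have : [set z1; z2] z2 by [right]; rewrite -e.
- by move=> z xz yz; have : [set z | edge x z /\ edge y z] z by []; rewrite e.
Qed.

Lemma no_three_apices u v x y z : edge u v ->
  edge u x -> edge v x -> edge u y -> edge v y -> edge u z -> edge v z ->
  x <> y -> x <> z -> y = z.
Proof.
move=> /two_apices[z1 [z2 [_ _ _ h]]] ux vx uy vy uz vz xy xz.
have [] := h x ux vx; have [] := h y uy vy; have [] := h z uz vz; congruence.
Qed.

Lemma exists_removable A x :
  finite_set A -> A x -> exists2 y, A y & removable A y.
Proof.
have [_ _ _ rem] := (model_farey_axioms M).1 HM.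
by move=> fA Ax; apply: rem => //; exists x.
Qed.

Lemma removable_adj A x y z : removable A x -> A y -> A z ->
  edge x y -> edge x z -> y <> z -> edge y z.
Proof.
move=> [h|[a [b [ab nb eab]]]] Ay Az xy xz yz; first by case: yz; apply: h.
have : neighbours A x y by []. have : neighbours A x z by [].
rewrite nb => -[zE|zE] [yE|yE]; rewrite zE yE in yz *; try by case: yz.
  exact: edgeC.
by [].
Qed.

Lemma removable_three A x y z t : removable A x -> A y -> A z -> A t ->
  edge x y -> edge x z -> edge x t -> y <> z -> y <> t -> z = t.
Proof.
move=> [h|[a [b [ab nb eab]]]] Ay Az At xy xz xt yz yt.
  by case: yz; apply: h.
have : neighbours A x y by []. have : neighbours A x z by [].
have : neighbours A x t by [].
by rewrite nb => -[] ? [] ? [] ?; congruence.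
Qed.

Definition walk n w := forall i, i < n -> edge (w i) (w i.+1).
Definition simple n w := forall i j, i <= n -> j <= n -> w i = w j -> i = j.
Definition skip (T : Type) k (w : nat -> T) i := w (if i < k then i else i.+1).

Lemma skip_lt (T : Type) k (w : nat -> T) i : i < k -> skip k w i = w i.
Proof. by rewrite /skip => ->. Qed.

Lemma skip_ge (T : Type) k (w : nat -> T) i : k <= i -> skip k w i = w i.+1.
Proof. by rewrite /skip ltnNge => ->. Qed.

Lemma walk_shift n k w : walk (n + k) w -> walk n (fun i => w (i + k)).
Proof. by move=> h i ni /=; rewrite addSn; apply: h; lia. Qed.

Lemma walk_skip n k w : walk n.+1 w -> 0 < k <= n -> edge (w k.-1) (w k.+1) ->
  walk n (skip k w).
Proof.
move=> ww kn e i ni; rewrite /skip.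
have [ik|ik] := ltnP i k; have [jk|jk] := ltnP i.+1 k; try lia.
- by apply: ww; lia.
- have -> : i = k.-1 by lia.
  by have -> : k.-1.+2 = k.+1 by lia.
- by apply: ww; lia.
Qed.

Lemma simple_skip n k w : simple n.+1 w -> simple n (skip k w).
Proof.
by move=> sw i j ni nj; rewrite /skip => /sw; do !case: ifP => ?; lia.
Qed.

(** The vertices of a cycle have two neighbours in it, so the removable one
    among them has adjacent neighbours. *)
Lemma ear n w : walk n w -> simple n w -> 1 < n -> edge (w 0) (w n) ->
  exists2 l, 0 < l < n & edge (w l.-1) (w l.+1).
Proof.
elim: n w => // n IH w ww sw n1 e.
have [||_ [l ln <-] rl] := @exists_removable (w @` `I_n.+2) (w 0).
- exact/finite_image/finite_II.
- by exists 0.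
have {}ln : l < n.+2 := ln.
have Aw i : i < n.+2 -> (w @` `I_n.+2) (w i) by move=> h; exists i.
have wn i j : i <= n.+1 -> j <= n.+1 -> i <> j -> w i <> w j.
  by move=> hi hj ij /sw; apply: contra_not ij; apply.
have [n1'|n2] := eqVneq n 1.
  by exists 1; rewrite ?n1' //= -n1'.
(* A removable end of the walk is no ear, but its two neighbours on the cycle are adjacent and close
   a shorter cycle, whose interior ear is an ear here as well. *)
have [l0|l0] := eqVneq l 0.
  rewrite {}l0 in rl ln.
  have e1 : edge (w 1) (w n.+1).
    apply: (removable_adj rl (Aw 1 _) (Aw n.+1 _) (ww 0 _) e) => //.
    by apply: wn; lia.
  have [||||m hm em] := IH (fun i => w (i + 1)); rewrite ?addn1 //.
  - by apply: walk_shift; rewrite addn1.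
  - by move=> i j ni nj /sw; lia.
  - by lia.
  - exists m.+1; first by lia.
    by move: em; rewrite !addn1 (_ : m.-1.+1 = m) //; lia.
have [l1|l1] := eqVneq l n.+1.
  rewrite {}l1 in rl ln.
  have e1 : edge (w 0) (w n).
    apply: (removable_adj rl (Aw 0 _) (Aw n _)); try by [].
    - exact: edgeC.
    - exact/edgeC/ww.
    - by apply: wn; lia.
  have [||||m hm em] := IH w => //.
  - by move=> i ni; apply: ww; lia.
  - by move=> i j ni nj; apply: sw; lia.
  - by lia.
  - by exists m => //; lia.
exists l; first by lia.
apply: (removable_adj rl (Aw l.-1 _) (Aw l.+1 _)); try lia.
- by apply: edgeC; have := ww l.-1; rewrite prednK; [apply; lia|lia].
- by apply: ww; lia.
- by apply: wn; lia.
Qed.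

(** Cutting off ears keeps the closing edge, until only a triangle on it is left. *)
Lemma apex_on_walk n w : walk n w -> simple n w -> 1 < n -> edge (w 0) (w n) ->
  exists2 l, 0 < l < n & edge (w l) (w 0) /\ edge (w l) (w n).
Proof.
elim: n w => // n IH w ww sw n1 e.
have [n1'|n2] := eqVneq n 1.
  rewrite {}n1' in ww sw e n1 *.
  by exists 1 => //; split; [apply/edgeC/ww|apply/ww].
have [l hl el] := ear ww sw n1 e.
have [||||m hm [m0 mn]] := IH (skip l w).
- by apply: walk_skip => //; lia.
- exact: simple_skip.
- by lia.
- by rewrite skip_lt ?skip_ge //; lia.
rewrite -(@skip_lt _ l w 0) -1?(@skip_ge _ l w n); [|lia|lia].
by exists (if m < l then m else m.+1) => //; case: ifP; lia.
Qed.

(** Closed subwalks are cut out. Interior vertices of the result come from the interior of [w], so a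
    walk whose interior avoids a given set may be assumed simple. *)
Lemma walk_shorten n w : walk n w -> exists m w',
  [/\ walk m w', simple m w', w' 0 = w 0, w' m = w n &
      forall i, 0 < i < m -> exists2 j, 0 < j < n & w' i = w j].
Proof.
elim/ltn_ind: n w => n IH w ww.
have [sw|] := pselect (simple n w).
  by exists n, w; split=> // i ni; exists i.
move=> /existsNP[i /existsNP[j]].
wlog ij : i j / i < j => [W|].
  have [ij|ij|->] := ltngtP i j; [exact: W| |by move=> []].
  move=> h; apply: (W j i) => // h'; apply: h => hi hj e.
  by apply/esym; apply: h'.
move=> /not_implyP[ni /not_implyP[nj /not_implyP[wij _]]].
pose w1 k := w (if k <= i then k else k + (j - i)).
have [||m [w' [ww' sw' e0 em h]]] := IH (n - (j - i)) _ w1; first by lia.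
  move=> k kn; rewrite /w1; have [ki|ki] := leqP k i.
    have [ki'|ki'] := leqP k.+1 i; first by apply: ww; lia.
    have -> : k = i by lia.
    by rewrite wij (_ : i.+1 + (j - i) = j.+1); [apply: ww|]; lia.
  by rewrite ifF ?addSn; [apply: ww; lia|lia].
exists m, w'; split=> //.
- rewrite em /w1; case: leqP => hh; last by congr w; lia.
  have -> : n = j by lia.
  by rewrite -wij; congr w; lia.
- move=> k /h[l ln ->]; rewrite /w1; case: leqP => hl.
    by exists l; [lia|].
  by exists (l + (j - i)); [lia|].
Qed.

(** Otherwise a cycle through [u] (or [v]) has only one ear, next to [u] (or
    [v]), which makes [w 1] a third apex of [uv]. *)
Lemma apices_separated u v n w : edge u v -> walk n w -> simple n w ->
  (forall i, i <= n -> w i <> u /\ w i <> v) ->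
  edge u (w 0) -> edge v (w 0) -> edge u (w n) -> edge v (w n) -> n = 0.
Proof.
elim: n w => // n IH w uv ww sw nw u0 v0 un vn; exfalso.
have n0 : w 0 <> w n.+1 by move=> /sw; lia.
have [n1|n1] := eqVneq n 0.
  rewrite {}n1 in ww sw nw un vn n0 *.
  have e01 := ww 0 isT.
  (* These four vertices span a complete graph, in which nothing is removable. *)
  pose A : set M := [set u; v] `|` [set w 0; w 1].
  have Au : A u by do 2 left.
  have Av : A v by left; right.
  have Ax : A (w 0) by right; left.
  have Ay : A (w 1) by do 2 right.
  have [|y] := @exists_removable A u _ Au.
    by rewrite !finite_setU; do !split; apply: finite_set1.
  have [nu0 nv0] := nw 0 isT; have [nu1 nv1] := nw 1 isT.
  have nuv := edge_neq uv.
  have vu := edgeC uv; have w0u := edgeC u0; have w0v := edgeC v0.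
  have w1u := edgeC un; have w1v := edgeC vn; have e10 := edgeC e01.
  move=> [[->|->]|[->|->]] ry.
  - by apply: n0; apply: (removable_three ry Av Ax Ay) => //; apply: nesym.
  - by apply: n0; apply: (removable_three ry Au Ax Ay) => //; apply: nesym.
  - by apply: nv1; apply/esym/(removable_three ry Au Av Ay) => //; apply: nesym.
  - by apply: nv0; apply/esym/(removable_three ry Au Av Ax) => //; apply: nesym.
suff [u1 v1] : edge u (w 1) /\ edge v (w 1).
  have := @no_three_apices u v (w 0) (w 1) (w n.+1) uv u0 v0 u1 v1 un vn.
  by move=> h; have /sw : w 1 = w n.+1; [apply: h => // /sw|]; lia.
have side x : edge x (w 0) -> edge x (w n.+1) -> (forall i, i <= n.+1 -> w i <> x) ->
    edge x (w 1).
  move=> x0 xn nx; pose w1 i := if i is j.+1 then w j else x.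
  have [||//|//|l hl el] := @ear n.+2 w1.
  - by move=> [|i] hi //; apply: ww; lia.
  - move=> [|i] [|j] hi hj //=.
    + by move=> /esym/nx; lia.
    + by move=> /nx; lia.
    + by move=> /sw ->; lia.
  (* The ear at index 1 is [w 0] and gives the edge sought. Any other ear lies inside [w], and
     skipping it leaves a shorter walk to which induction applies. *)
  have [l1|l1] := eqVneq l 1; first by rewrite l1 in el.
  have ww' : walk n (skip l.-1 w).
    apply: walk_skip => //; first by lia.
    by move: el; case: (l) hl l1 => [|[]].
  have n0' : n = 0; last by lia.
  apply: (IH (skip l.-1 w) uv ww') => //.
  - exact: simple_skip.
  - by move=> i ni; apply: nw; case: ifP; lia.
  - by rewrite skip_lt //; lia.
  - by rewrite skip_lt //; lia.
  - by rewrite skip_ge //; lia.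
  - by rewrite skip_ge //; lia.
by split; apply: side => // i ni; have [] := nw i ni.
Qed.

(** Otherwise [v] and its neighbours form a finite subgraph that contains both apices of every edge
    at [v]. Each of its vertices then has three neighbours in it, so none is removable. *)
Lemma infinite_neighbours v : infinite_set [set x | edge v x].
Proof.
have [_ iso _ _] := (model_farey_axioms M).1 HM.
have [x0 vx0] := iso v.
move=> fN; pose A := v |` [set x | edge v x].
have Av : A v by left.
have AN x : edge v x -> A x by right.
have [|y Ay ry] := @exists_removable A v _ Av.
  by rewrite finite_setU; split=> //; apply: finite_set1.
have [vy|nvy] := pselect (edge v y).
  have [z1 [z2 [z12 [vz1 yz1] [vz2 yz2] _]]] := two_apices vy.
  apply: z12; apply: (removable_three ry Av) => //; try exact: AN.
  - exact: edgeC.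
  - exact: edge_neq.
  - exact: edge_neq.
have {Ay nvy} yv : y = v by case: Ay.
rewrite {}yv in ry.
have [z1 [z2 [z12 [vz1 yz1] [vz2 yz2] _]]] := two_apices vx0.
apply: z12; apply: (removable_three ry (AN _ vx0)) => //; try exact: AN.
- exact: edge_neq.
- exact: edge_neq.
Qed.

End Walks.

(** * Formulas and ultrapowers *)

Section Constants.
Variables C D : Type.

Definition map_term (g : C -> D) (t : term C) : term D :=
  match t with Var x => Var x | Cst c => Cst (g c) end.

Fixpoint map_form (g : C -> D) (p : form C) : form D :=
  match p with
  | Fal => Fal
  | Eq s t => Eq (map_term g s) (map_term g t)
  | Adj s t => Adj (map_term g s) (map_term g t)
  | Imp p q => Imp (map_form g p) (map_form g q)
  | All x p => All x (map_form g p)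
  end.

Definition term_cst (t : term C) : set C :=
  if t is Cst c then [set c] else set0.

Fixpoint form_cst (p : form C) : set C :=
  match p with
  | Fal => set0
  | Eq s t | Adj s t => term_cst s `|` term_cst t
  | Imp p q => form_cst p `|` form_cst q
  | All _ p => form_cst p
  end.

Lemma sat_map (M : structure) (k : D -> M) g v p :
  sat k v (map_form g p) = sat (k \o g) v p.
Proof.
have et w t : eval k w (map_term g t) = eval (k \o g) w t by case: t.
elim: p v => //= [s t|s t|p IHp q IHq|x p IHp] v; rewrite ?et //.
  by rewrite IHp IHq.
by apply/propext; split=> h a; have := h a; rewrite IHp.
Qed.

Lemma fvars_map g p : fvars (map_form g p) = fvars p.
Proof.
have et t : tvars (map_term g t) = tvars t by case: t.
by elim: p => //= [s t|s t|p -> q ->|x p ->]; rewrite ?et.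
Qed.

End Constants.

Lemma finite_form_cst C (p : form C) : finite_set (form_cst p).
Proof.
have ft (t : term C) : finite_set (term_cst t).
  by case: t => //= c; apply: finite_set1.
by elim: p => //= *; rewrite finite_setU.
Qed.

Lemma sat_eq (M : structure) C (k : C -> M) v v' p :
  {in fvars p, v =1 v'} -> sat k v p <-> sat k v' p.
Proof.
have et (w w' : nat -> M) t : {in tvars t, w =1 w'} -> eval k w t = eval k w' t.
  by case: t => //= x; apply; rewrite inE.
elim: p v v' => //= [s t|s t|p IHp q IHq|x p IHp] v v' h.
1,2: by rewrite (et v v') 1?(et v v' t) // => x xt;
  apply: h; rewrite mem_cat xt ?orbT.
- rewrite (IHp v v') ?(IHq v v') // => x xt;
  by apply: h; rewrite mem_cat xt ?orbT.
- suff e a : sat k (upd v x a) p <-> sat k (upd v' x a) p.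
    by split=> H a; apply/e.
  apply: IHp => y yp; rewrite /upd; case: eqVneq => // yx.
  by apply: h; rewrite mem_filter yx.
Qed.

Lemma sat_Alls (M : structure) C (k : C -> M) u n p :
  sat k u (Alls n p) <-> forall v, (forall x, n <= x -> v x = u x) -> sat k v p.
Proof.
elim: n p => [|n IH] p /=.
  split=> [h v vu|]; last by apply.
  by rewrite (_ : v = u) //; apply/funext => x; apply: vu.
rewrite IH; split=> [h v vu|h v vu a]; last first.
  by apply: h => x nx; rewrite /upd; case: eqP => [|_]; [lia|apply: vu; lia].
have -> : v = upd (upd v n (u n)) n (v n).
  by apply/funext => x; rewrite /upd; case: eqP => [->|].
apply: h => x nx; rewrite /upd; case: eqP => [-> //|xn]; apply: vu; lia.
Qed.

Section InVars.
Variable C : Type.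
Implicit Types p q : form C.

Lemma in_varsI n p q : in_vars n (Imp p q) = in_vars n p && in_vars n q.
Proof. by rewrite /in_vars all_cat. Qed.

Lemma in_varsN n p : in_vars n (Neg p) = in_vars n p.
Proof. by rewrite in_varsI andbT. Qed.

Lemma in_varsA n p q : in_vars n (And p q) = in_vars n p && in_vars n q.
Proof. by rewrite in_varsN in_varsI in_varsN. Qed.

Lemma in_varsO n p q : in_vars n (Or p q) = in_vars n p && in_vars n q.
Proof. by rewrite in_varsI in_varsN. Qed.

Lemma in_vars_All n p : in_vars n.+1 p -> in_vars n (All n p).
Proof.
rewrite /in_vars /= all_filter; apply: sub_all => x /= xn.
by apply/implyP => /eqP; lia.
Qed.

Lemma in_vars_Ex n p : in_vars n.+1 p -> in_vars n (Ex n p).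
Proof. by rewrite in_varsN => h; apply: in_vars_All; rewrite in_varsN. Qed.

Definition fresh m (t : term C) : bool := all (fun i => i < m) (tvars t).

Lemma in_vars_Eq n s t : in_vars n (Eq s t) = fresh n s && fresh n t.
Proof. by rewrite /in_vars /= all_cat. Qed.

Lemma in_vars_Adj n s t : in_vars n (Adj s t) = fresh n s && fresh n t.
Proof. by rewrite /in_vars /= all_cat. Qed.

End InVars.

Lemma in_vars_Alls C n (p : form C) : in_vars n p -> in_vars 0 (Alls n p).
Proof. by elim: n p => //= n IH p pn; apply/IH/in_vars_All. Qed.

Lemma in_vars_bigA C n m (P : pred 'I_m) (F : 'I_m -> form C) :
  (forall i, P i -> in_vars n (F i)) ->
  in_vars n (\big[And/Top]_(i < m | P i) F i).
Proof.
move=> h; elim/big_ind: _ => //= p q hp hq.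
by rewrite in_varsA hp.
Qed.

Lemma in_vars_bigO C n m (F : 'I_m -> form C) :
  (forall i, in_vars n (F i)) -> in_vars n (\big[Or/Fal]_(i < m) F i).
Proof.
move=> h; elim/big_ind: _ => //= p q hp hq.
by rewrite in_varsO hp.
Qed.

Section Encoding.
Variables (C : Type) (g : C -> nat).

(** Trees over [nat] form a [countType], so they can index a set of formulas over countably many
    constants when [saturated] is applied. *)
Definition enc_term (t : term C) : GenTree.tree nat :=
  match t with
  | Var x => GenTree.Node 0 [:: GenTree.Leaf x]
  | Cst c => GenTree.Node 1 [:: GenTree.Leaf (g c)]
  end.

Fixpoint enc_form (p : form C) : GenTree.tree nat :=
  match p with
  | Fal => GenTree.Node 0 [::]
  | Eq s t => GenTree.Node 1 [:: enc_term s; enc_term t]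
  | Adj s t => GenTree.Node 2 [:: enc_term s; enc_term t]
  | Imp p q => GenTree.Node 3 [:: enc_form p; enc_form q]
  | All x p => GenTree.Node 4 [:: GenTree.Leaf x; enc_form p]
  end.

Lemma enc_form_inj : injective g -> injective enc_form.
Proof.
move=> gI.
have et : injective enc_term by move=> [x|c] [y|d] //= [] => [->|/gI->].
elim=> [|s t|s t|p IHp q IHq|x p IHp] [|s' t'|s' t'|p' q'|x' p'] //= [].
- by move=> /et-> /et->.
- by move=> /et-> /et->.
- by move=> /IHp-> /IHq->.
- by move=> -> /IHp->.
Qed.

End Encoding.

(** This is saturation for countable families, in infinitely many variables at once and with
    arbitrary parameters. *)
Definition saturated (N : structure) : Prop :=
  forall (I : countType) (phi : I -> form N),
  (forall s : seq I, exists v, forall i, i \in s -> sat id v (phi i)) ->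
  exists v, forall i, sat id v (phi i).

Section Ultrapower.
Variables (M : structure) (U : set_system nat).
Hypothesis UU : UltraFilter U.

Definition germ (f : nat -> M) : set (nat -> M) :=
  [set g | U [set m | f m = g m]].

Definition germs : Type := {X : set (nat -> M) | exists f, X = germ f}.

Definition to_germ (f : nat -> M) : germs := exist _ (germ f) (ex_intro _ f erefl).

Lemma germ_eq f g : germ f = germ g <-> U [set m | f m = g m].
Proof.
split=> [e|h]; last first.
  by apply/predeqP => h'; split=> /= H; apply: filterS2 h H => m /= ->.
have : germ g g by apply: (filterS _ filterT) => m.
by rewrite -e.
Qed.

(** The representative of a constant germ is a constant function, so that
    evaluating the diagonal image of [a] at any index gives [a]. *)
Lemma repr_subproof (X : germs) : exists f,
  sval X = germ f /\ forall a, sval X = germ (fun=> a) -> f = fun=> a.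
Proof.
case: X => X [f e] /=.
have [[a ea]|na] := pselect (exists a, X = germ (fun=> a)).
  exists (fun=> a); split=> // b; rewrite ea => /germ_eq/filter_ex[m /= ab].
  by rewrite ab.
by exists f; split=> // a ea; case: na; exists a.
Qed.

Definition repr (X : germs) : nat -> M := sval (cid (repr_subproof X)).

Lemma reprP X : sval X = germ (repr X).
Proof. by have [] := svalP (cid (repr_subproof X)). Qed.

Lemma repr_to_germ f : U [set m | repr (to_germ f) m = f m].
Proof. by apply/germ_eq; rewrite -reprP. Qed.

Lemma repr_cst a : repr (to_germ (fun=> a)) = fun=> a.
Proof.
by have [_ h] := svalP (cid (repr_subproof (to_germ (fun=> a)))); apply: h.
Qed.

Lemma germsP (X Y : germs) : X = Y <-> U [set m | repr X m = repr Y m].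
Proof.
rewrite -germ_eq -!reprP; split=> [-> //|].
by case: X Y => [X eX] [Y eY] /= XY; apply: eq_exist.
Qed.

Lemma germs_inhabited : inhabited germs.
Proof. by have [a] := structure_nonempty M; split; apply: to_germ => _. Qed.

Definition ultrapower : structure :=
  @Structure germs (fun X Y => U [set m | edge (repr X m) (repr Y m)])
    germs_inhabited.

(** Łoś's theorem. Implication uses that one of a set and its complement is in [U]; for the
    quantifier, a counterexample is chosen at each index that has one. *)
Lemma los C (k : C -> ultrapower) v p :
  sat k v p <->
  U [set m | sat (fun c => repr (k c) m) (fun x => repr (v x) m) p].
Proof.
have et t m w : repr (eval k w t) m =
    eval (fun c => repr (k c) m) (fun x => repr (w x) m) t by case: t.
elim: p v => [|s t|s t|p IHp q IHq|x p IHp] v /=.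
- by split=> // /filter_not_empty.
- by rewrite germsP; under eq_set do rewrite !et.
- by under eq_set do rewrite !et.
- split=> [h|h /IHp hp].
    have [/IHp/h/IHq|] := in_ultra_setVsetC
        [set m | sat (fun c => repr (k c) m) (fun x => repr (v x) m) p] UU.
      by apply: filterS => m /=.
    by apply: filterS => m /= np /np.
  by apply/IHq; apply: filterS2 h hp => m /=; apply.
- have eu a m : (fun y => repr (upd v x a y) m) =
      upd (fun y => repr (v y) m) x (repr a m).
    by apply/funext => y; rewrite /upd; case: eqP.
  split=> [h|h a]; last first.
    by apply/IHp; apply: filterS h => m /= h; rewrite eu.
  have [//|nU] := in_ultra_setVsetC [set m | forall a,
      sat (fun c => repr (k c) m) (upd (fun y => repr (v y) m) x a) p] UU.
  have /choice[f hf] : forall m, exists a, ~ (forall a,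
      sat (fun c => repr (k c) m) (upd (fun y => repr (v y) m) x a) p) ->
      ~ sat (fun c => repr (k c) m) (upd (fun y => repr (v y) m) x a) p.
    move=> m; have [H|/existsNP[a na]] := pselect (forall a,
      sat (fun c => repr (k c) m) (upd (fun y => repr (v y) m) x a) p).
      by exists (repr (v 0) m) => /(_ H).
    by exists a.
  have /IHp hU := h (to_germ f).
  suff : U set0 by move=> /filter_not_empty.
  apply: filterS3 nU hU (repr_to_germ f) => m /= /hf ns.
  by rewrite eu => + ef; rewrite ef.
Qed.

Definition diag (a : M) : ultrapower := to_germ (fun=> a).

Lemma sat_diag C (k : C -> M) v p :
  sat (diag \o k) (diag \o v) p <-> sat k v p.
Proof.
rewrite los.
have -> : [set m | sat (fun c => repr ((diag \o k) c) m)
    (fun x => repr ((diag \o v) x) m) p] = [set _ | sat k v p].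
  apply/predeqP => m /=.
  have -> : (fun c => repr (diag (k c)) m) = k.
    by apply/funext => c; rewrite /diag repr_cst.
  by have -> : (fun x => repr (diag (v x)) m) = v
    by apply/funext => x; rewrite /diag repr_cst.
split=> [/filter_ex[]//|h]; exact: (filterS _ filterT).
Qed.

Hypothesis Uoo : \oo `<=` U.

Lemma ultrapower_saturated : saturated ultrapower.
Proof.
move=> I phi fs.
pose sol m (v : nat -> M) i := sat (fun c => repr c m) v (phi i).
pose P m n := exists v, forall i, pickle i < n -> sol m v i.
have PU n : U [set m | P m n].
  have [v hv] := fs (pmap unpickle (iota 0 n)).
  have : U [set m | forall i, i \in pmap unpickle (iota 0 n) ->
                    sol m (fun x => repr (v x) m) i].
    elim: (pmap _ _) hv => [_|i s IH hv].
      by apply: (filterS _ filterT) => m.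
    have /los Ui : sat id v (phi i) by apply: hv; rewrite inE eqxx.
    apply: filterS2 Ui (IH _) => [m /= hi hs j|j js].
      by rewrite inE => /orP[/eqP->|/hs].
    by apply: hv; rewrite inE js orbT.
  apply: filterS => m h; exists (fun x => repr (v x) m) => i ni.
  apply: h; rewrite mem_pmap; apply/mapP; exists (pickle i).
    by rewrite mem_iota add0n.
  by rewrite pickleK.
(* A single assignment solves as long an initial segment of the family as can be solved at index
   [m], up to length [b]. On the diagonal [b] is [m], so the length is eventually no restriction. *)
have best m b : exists v, forall n, n <= b -> P m n ->
    forall i, pickle i < n -> sol m v i.
  elim: b => [|b [v hv]].
    have [a] := structure_nonempty M.
    by exists (fun=> a) => n; rewrite leqn0 => /eqP-> _ i.
  have [[u hu]|nP] := pselect (P m b.+1).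
    by exists u => n nb _ i ni; apply: hu; lia.
  exists v => n; rewrite leq_eqVlt => /predU1P[->//|]; exact: hv.
have /choice[f hf] := fun m => best m m.
exists (fun x => to_germ (fun m => f m x)) => i; apply/los.
(* Only the finitely many variables of [phi i] matter, so almost everywhere the representatives
   agree with [f m] on all of them. *)
have Ufv : U [set m | {in fvars (phi i), forall x,
    repr (to_germ (fun m => f m x)) m = f m x}].
  elim: (fvars _) => [|x s IH]; first by apply: (filterS _ filterT) => m.
  apply: filterS2 (repr_to_germ (fun m => f m x)) IH => m /= ex es y.
  by rewrite inE => /orP[/eqP->|/es].
have Ug : U [set m | (pickle i).+1 <= m] by apply: Uoo; exists (pickle i).+1.
apply: filterS3 Ufv (PU (pickle i).+1) Ug => m /= hv hP hm.
by apply/(sat_eq _ hv); apply: hf hP _ _.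
Qed.

End Ultrapower.

Lemma saturated_extension (M : structure) : exists (N : structure) (j : M -> N),
  saturated N /\ forall C (k : C -> M) v p,
    sat (j \o k) (j \o v) p <-> sat k v p.
Proof.
have [U [UU Uoo]] := ultraFilterLemma eventually_filter.
exists (ultrapower M UU), (@diag M U UU); split; first exact: ultrapower_saturated.
exact: sat_diag.
Qed.

(** * Strong sets and their extensions *)

(** The ways to add a vertex: in a new component, as a neighbour of entry [a], or as an apex on
    entries [a] and [b]. *)
Variant instr := Iso | Nbr of nat | Apx of nat & nat.

Definition enc_instr c : option (nat + nat * nat) :=
  match c with
  | Iso => None | Nbr a => Some (inl a) | Apx a b => Some (inr (a, b))
  end.

Definition dec_instr c : instr :=
  match c with
  | None => Iso | Some (inl a) => Nbr a | Some (inr (a, b)) => Apx a b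
  end.

Lemma enc_instrK : cancel enc_instr dec_instr. Proof. by case. Qed.

HB.instance Definition _ := Countable.copy instr (can_type enc_instrK).

Definition is_nbr c := if c is Nbr _ then true else false.

Definition scons (T : Type) (z : T) (e : nat -> T) : nat -> T :=
  fun i => if i is j.+1 then e j else z.

Section Runs.
Variable M : structure.
Implicit Types (e f : nat -> M) (x y z : M) (s : seq instr).

Definition rng e : set M := [set x | exists i, e i = x].

(** An environment [e] enumerates a set of vertices; each instruction adds a
    vertex at position 0, and refers to the earlier ones by position. *)
Definition follows e c z : Prop :=
  match c with
  | Iso => False
  | Nbr a => edge (e a) z
  | Apx a b => [/\ edge (e a) (e b), edge (e a) z & edge (e b) z]
  end.

(** Runs are loose: a neighbour need not be generic and the added vertex may be an old one. This
    makes [reach] expressible by a formula; the generic counterpart is [steps]. *)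
Fixpoint run e s f : Prop :=
  if s is c :: s' then exists2 z, follows e c z & run (scons z e) s' f
  else f = e.

Definition reach e s i x : Prop := exists2 f, run e s f & f i = x.

(** In particular [far e 1 x] says that [x] cannot be obtained from [e] by apices alone, which is
    what makes a neighbour generic. *)
Definition far e k x : Prop :=
  forall s i, count is_nbr s < k -> ~ reach e s i x.

(** For [Iso], being unreachable means lying in a component that misses [e], by [walk_reach] and
    [reach_walk]. *)
Definition step e c z : Prop :=
  match c with
  | Iso => forall s i, ~ reach e s i z
  | Nbr a => edge (e a) z /\ far e 1 z
  | Apx a b => [/\ edge (e a) (e b), edge (e a) z, edge (e b) z & ~ rng e z]
  end.

Definition strong e : Prop := forall n w, walk n w ->
  rng e (w 0) -> rng e (w n) -> w 0 <> w n ->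
  (forall i, 0 < i < n -> ~ rng e (w i)) -> edge (w 0) (w n).

Lemma run_pos e s f i : run e s f -> f (size s + i) = e i.
Proof.
elim: s e i => [|c s IH] e i /= => [->//|[z _ /IH h]].
by have := h i.+1; rewrite addnS.
Qed.

Lemma run_cat e s f s' g : run e s f -> run f s' g -> run e (s ++ s') g.
Proof.
elim: s e => [e -> //|c s IH] e /= [z ez r] /(IH _ r); by exists z.
Qed.

Lemma reach0 e i : reach e [::] i (e i). Proof. by exists e. Qed.

Lemma step_fresh e c z : step e c z -> ~ rng e z.
Proof.
move=> st [i iz]; have := reach0 e i; rewrite iz; case: c st => [|a|a b] /=.
- by move=> h /h.
- by move=> [_ h] /h; apply.
- by move=> [_ _ _ nz]; case: nz; exists i.
Qed.

(** Instructions refer to positions, so they are translated along [r]; the vertex just added has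
    position 0 on both sides. *)
Lemma run_rename e e' s f (r : nat -> nat) :
  (forall i, e i = e' (r i)) -> run e s f ->
  exists s' f' r', [/\ run e' s' f', count is_nbr s' = count is_nbr s &
    forall i, f i = f' (r' i)].
Proof.
elim: s e e' r => [|c s IH] e e' r er /=.
  by move=> ->; exists [::], e', r.
pose ren c := match c with
  | Iso => Iso | Nbr a => Nbr (r a) | Apx a b => Apx (r a) (r b) end.
move=> [z ez /(IH _ (scons z e') (fun i => if i is j.+1 then (r j).+1 else 0))].
move=> [[|i]//=|s' [f' [r' [h1 h3 h4]]]].
exists (ren c :: s'), f', r'; split=> //=.
- by exists z => //; case: c ez => [|a|a b] //=; rewrite !er.
- by rewrite h3; case: c ez.
Qed.

Lemma reach_rename e e' s i x (r : nat -> nat) :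
  (forall i, e i = e' (r i)) -> reach e s i x ->
  exists s' i', reach e' s' i' x /\ count is_nbr s' = count is_nbr s.
Proof.
move=> er [f /(run_rename er)[s' [f' [r' [h1 h3 h4]]]] <-].
by exists s', (r' i); split=> //; exists f'.
Qed.

Lemma reach_after e s f s' i x : run e s f -> reach f s' i x ->
  reach e (s ++ s') i x.
Proof. by move=> r [g r' gx]; exists g => //; apply: run_cat r r'. Qed.

Lemma walk_reach e n w a : walk n w -> e a = w 0 ->
  exists s i, reach e s i (w n).
Proof.
elim: n => [_ <-|n IH ww /IH[]]; first by exists [::], a; apply: reach0.
  by move=> i ni; apply: ww; lia.
move=> s [i [f r fi]]; exists (rcons s (Nbr i)), 0.
rewrite -cats1; apply: reach_after r _; exists (scons (w n.+1) f) => //=.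
by exists (w n.+1) => //; rewrite fi; apply: ww.
Qed.

End Runs.

Lemma walk_rev (M : structure) (HM : model M farey_axioms) n (w : nat -> M) :
  walk n w -> walk n (fun i => w (n - i)).
Proof.
move=> ww i ni; apply: (edgeC HM).
have -> : n - i = (n - i.+1).+1 by lia.
by apply: ww; lia.
Qed.

Lemma walk_scons (M : structure) n (w : nat -> M) x :
  walk n w -> edge x (w 0) -> walk n.+1 (scons x w).
Proof. by move=> ww xw [|i] ni //; apply: ww. Qed.

Section Steps.
Variable M : structure.
Hypothesis HM : model M farey_axioms.
Implicit Types (e f : nat -> M) (x y z : M) (s : seq instr).

(** The cycle is triangulated from its closing edge: an apex of this edge on the walk splits the
    cycle in two, and [w l] is that apex or lies on one of the shorter cycles. *)
Lemma apx_reach e a b n w l : walk n w -> simple n w -> e a = w 0 ->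
  e b = w n -> edge (w 0) (w n) -> 0 < l < n ->
  exists s i, count is_nbr s = 0 /\ reach e s i (w l).
Proof.
elim/ltn_ind: n e a b w l => n IH e a b w l ww sw ea eb e0n ln.
have [|m mn [m0 mn']] := apex_on_walk HM ww sw _ e0n; first by lia.
suff [s [i [c0 r]]] : exists s i,
    count is_nbr s = 0 /\ reach (scons (w m) e) s i (w l).
  exists (Apx a b :: s), i; split=> //; case: r => f r fi.
  exists f => //; exists (w m) => //=; rewrite ea eb.
  by split=> //; apply: edgeC.
have [lm|lm|->] := ltngtP l m; last by exists [::], 0; split=> //; apply: reach0.
- apply: (IH m _ _ a.+1 0) => //; try by lia.
  + by move=> i im; apply: ww; lia.
  + by move=> i j im jm; apply: sw; lia.
  + exact: edgeC.
- rewrite -[l](@subnK m); last by lia.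
  apply: (IH (n - m) _ _ 0 b.+1 (fun i => w (i + m))).
  + by lia.
  + by apply: walk_shift; rewrite subnK //; lia.
  + by move=> i j im jm /sw; lia.
  + by rewrite add0n.
  + by rewrite /= subnK //; lia.
  + by rewrite add0n subnK //; lia.
  + by lia.
Qed.

(** A generic neighbour of [e a] is connected to [e] only through [e a]. If a walk entered at
    another [e b], strongness would give the edge from [e a] to [e b], closing a cycle through [z],
    and [z] would be obtained by apices alone. *)
Lemma step_gate e a z n w b : strong e -> step e (Nbr a) z -> walk n w ->
  w 0 = z -> w n = e b -> (forall i, 0 < i < n -> ~ rng e (w i)) -> e b = e a.
Proof.
move=> se st ww w0 wn wi; apply: contrapT => nba.
have nz := step_fresh st; case: st => az fz.
have [m [w' [ww' sw' e0 em wi']]] := walk_shorten ww.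
have m0 : m <> 0 by move=> m0; apply: nz; exists b; rewrite -wn -em m0 e0.
have ni i : i < m -> ~ rng e (w' i).
  case: i => [|i] im; first by rewrite e0 w0.
  by have [|j jn ->] := wi' i.+1; [lia|apply: wi].
have wa := walk_scons ww' (x := e a); rewrite e0 w0 in wa.
have ea i : i <= m -> w' i <> e a.
  rewrite leq_eqVlt => /predU1P[->|/ni h]; first by rewrite em wn.
  by move=> eia; apply: h; exists a.
have sa : simple m.+1 (scons (e a) w').
  by move=> [|i] [|j] hi hj //= => [/esym/ea|/ea|/sw' ->]//; lia.
have eab : edge (e a) (e b).
  have := se _ _ (wa az); rewrite /= em wn; apply.
  - by exists a.
  - by exists b.
  - exact: nesym.
  - by move=> [|i] //= im; apply: ni; lia.
have [s [i [c0 r]]] : exists s i, count is_nbr s = 0 /\ reach e s i z.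
  rewrite -w0 -e0 -[w' 0]/(scons (e a) w' 1).
  apply: (@apx_reach e a b m.+1) => //=; last by lia.
  - exact: wa.
  - by rewrite em wn.
  - by rewrite em wn.
by apply: (fz s i); rewrite ?c0.
Qed.

Lemma strong_scons e z : strong e ->
  (forall n w b, walk n w -> w 0 = z -> w n = e b ->
     (forall i, 0 < i < n -> ~ rng e (w i)) -> edge z (e b)) ->
  strong (scons z e).
Proof.
move=> se h n w ww r0 rn d wi.
have {}wi i : 0 < i < n -> ~ rng e (w i).
  by move=> /wi nr [j ej]; apply: nr; exists j.+1.
case: r0 rn => [[|a] /= ea] [[|b] /= eb].
- by case: d; rewrite -ea -eb.
- by rewrite -ea -eb; apply: h ww _ _ _.
- apply: (edgeC HM); rewrite -ea -eb; apply: h (walk_rev HM ww) _ _ _ => //=.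
  + by rewrite subn0.
  + by rewrite subnn.
  + by move=> i ni; apply: wi; lia.
- by apply: se => //; [exists a|exists b].
Qed.

Lemma step_strong e c z : strong e -> step e c z -> strong (scons z e).
Proof.
move=> se st; apply: strong_scons => // n w b ww w0 wn wi.
have nz := step_fresh st; case: c st => [|a|a a'] st.
- have [s [i]] : exists s i, reach e s i (w (n - n)).
    by apply: (walk_reach (walk_rev HM ww) (a := b)); rewrite subn0.
  by rewrite subnn w0 => /st.
- by rewrite (step_gate se st ww w0 wn wi); apply: (edgeC HM); case: st.
(* Were the walk to end at a third member [e b], strongness would join [e b] to both [e a] and
   [e a']. It would be an apex of that edge, connected to the apex [z] off the edge. *)
- case: st => aa az a'z _.
  have [->|nba] := pselect (e b = e a); first exact: (edgeC HM).
  have [->|nba'] := pselect (e b = e a'); first exact: (edgeC HM).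
  have [m [w' [ww' sw' e0 em wi']]] := walk_shorten ww.
  have m0 : m <> 0 by move=> m0; apply: nz; exists b; rewrite -wn -em m0 e0.
  have ni i : i < m -> ~ rng e (w' i).
    case: i => [|i] im; first by rewrite e0 w0.
    by have [|j jn ->] := wi' i.+1; [lia|apply: wi].
  have side y : rng e y -> edge y z -> e b <> y -> edge y (e b).
    move=> ry yz nby; have := walk_scons ww' (x := y).
    rewrite e0 w0 => /(_ yz)/se /=; rewrite em wn; apply => //.
    - by exists b.
    - exact: nesym.
    - by move=> [|i] //= im; apply: ni; lia.
  case: m0; apply: (@apices_separated _ HM (e a) (e a') m w') => //.
  + move=> i; rewrite leq_eqVlt => /predU1P[->|/ni h]; first by rewrite em wn.
    by split=> ei; apply: h; [exists a|exists a'].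
  + by rewrite e0 w0.
  + by rewrite e0 w0.
  + by rewrite em wn; apply: side => //; exists a.
  + by rewrite em wn; apply: side => //; exists a'.
Qed.

Lemma step_edge e c z l : strong e -> step e c z -> edge z (e l) <->
  match c with
  | Iso => False | Nbr a => e l = e a | Apx a b => e l = e a \/ e l = e b end.
Proof.
move=> se st; have nz := step_fresh st; split; last first.
  by case: c st => [|a|a b] //= [] => [az _ ->|_ az bz _ [->|->]];
     apply: (edgeC HM).
move=> zl; pose w := scons z (fun=> e l).
have ww : walk 1 w by move=> [].
case: c st => [|a|a b] st.
- apply: (st [:: Nbr l] 0); exists (scons z e) => //=.
  by exists z => //=; apply: (edgeC HM).
- by apply: (step_gate se st ww) => // -[].
- have [la|nla] := pselect (e l = e a); first by left.
  have [lb|nlb] := pselect (e l = e b); first by right.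
  case: st => ab az bz _.
  have side y : rng e y -> edge y z -> e l <> y -> edge y (e l).
    move=> ry yz nly; apply: (se 2 (scons y w)) => //=.
    - by move=> [|[|i]].
    - by exists l.
    - exact: nesym.
    - by move=> [|[|i]].
  suff : 1 = 0 by [].
  apply: (@apices_separated _ HM (e a) (e b) 1 w ab ww) => //.
  + move=> [|[|i]] [|[|j]] //= _ _ h; first by case: nz; exists l.
    by case: nz; exists l.
  + move=> [|[|i]] //= _; split=> // h; apply: nz; rewrite h.
      by exists a.
    by exists b.
  + by apply: side => //; exists a.
  + by apply: side => //; exists b.
Qed.

End Steps.

(** * Back and forth *)

Section ReachFormula.
Variable C : Type.
Implicit Types t : nat -> term C.

Definition follows_form t c m : form C :=
  match c with
  | Iso => Fal
  | Nbr a => Adj (t a) (Var m)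
  | Apx a b => And (Adj (t a) (t b)) (And (Adj (t a) (Var m)) (Adj (t b) (Var m)))
  end.

(** The formula says that x_0 is entry [i] of the result of some run of [s] from
    [t]; the variables from x_m on must not occur in [t]. *)
Fixpoint reach_form s i t m : form C :=
  if s is c :: s' then
    Ex m (And (follows_form t c m) (reach_form s' i (scons (Var m) t) m.+1))
  else Eq (t i) (Var 0).

Lemma sat_reach (M : structure) (k : C -> M) v s i t m : 0 < m ->
  (forall j x, t j = Var x -> x < m) ->
  sat k v (reach_form s i t m) <-> reach (fun j => eval k v (t j)) s i (v 0).
Proof.
elim: s t v m => [|c s IH] t v m m0 tm.
  by rewrite /=; split=> [e|[_ ->]//]; eexists.
have vm x : v 0 = upd v m x 0 by rewrite /upd ifF //; lia.
have et j x : eval k (upd v m x) (t j) = eval k v (t j).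
  case tj : (t j) => [y|//] /=; rewrite /upd ifF //.
  by have := tm _ _ tj; lia.
have es x : (fun j => eval k (upd v m x) (scons (Var m) t j)) =
    scons x (fun j => eval k v (t j)).
  by apply/funext => -[|j] /=; rewrite ?et // /upd eqxx.
have fo x : sat k (upd v m x) (follows_form t c m) <->
    follows (fun j => eval k v (t j)) c x.
  have um : upd v m x m = x by rewrite /upd eqxx.
  case: (c) => [|a|a b] //; first by rewrite /= et um.
  rewrite !satA /= !et um; split; first by case=> ? [].
  by case.
rewrite [reach_form _ _ _ _]/= satE; split=> [[x /satA[/fo fx]]|[f [x fx r] fi]].
  rewrite IH // => [|[|j] y /=]; last 2 first.
  - by case=> <-.
  - by move=> /tm; lia.
  by rewrite es -vm => -[f r fi]; exists f => //; exists x.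
exists x; apply/satA; split; first exact/fo.
rewrite IH // => [|[|j] y /=]; last 2 first.
- by case=> <-.
- by move=> /tm; lia.
by rewrite es -vm; exists f.
Qed.

End ReachFormula.

Definition reach_from (M : structure) (e : nat -> M) (si : seq instr * nat) :
  form M := reach_form si.1 si.2 (fun j => Cst (e j)) 1.

Lemma sat_reach_from (M : structure) (e v : nat -> M) si :
  sat id v (reach_from e si) <-> reach e si.1 si.2 (v 0).
Proof. exact: sat_reach. Qed.

(** * Capturing vertices, and existence of generic ones *)

Section Extension.
Variable M : structure.
Hypothesis HM : model M farey_axioms.
Implicit Types (e f : nat -> M) (x y z : M) (s : seq instr).

(** Without [Nbr], each instruction leaves at most two choices. *)
Lemma finite_reach e s i : count is_nbr s = 0 ->
  finite_set [set z | reach e s i z].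
Proof.
elim: s e => [|[|a|a b] s IH] e //=.
- move=> _; apply: sub_finite_set (finite_set1 (e i)) => z [f -> <-] //.
- by move=> _; apply: sub_finite_set (finite_set0 M) => z [f [x []]].
- move=> c0; have [ab|nab] := pselect (edge (e a) (e b)); last first.
    by apply: sub_finite_set (finite_set0 M) => z [f [x []]].
  have [z1 [z2 [_ _ _ h]]] := two_apices HM ab.
  have := IH (scons z2 e) c0; have := IH (scons z1 e) c0 => h1 h2.
  have := conj h1 h2; rewrite -finite_setU; apply: sub_finite_set.
  move=> z [f [x [_ ax bx] r] fi].
  by case: (h x ax bx) r => -> r; [left|right]; exists f.
Qed.

Lemma reach_walk e s i x : reach e s i x -> exists n w b,
  [/\ n <= size s, walk n w, w 0 = e b & w n = x].
Proof.
elim: s e => [|c s IH] e.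
  by move=> [f -> <-]; exists 0, (fun=> e i), i.
move=> [f [z ez r] fi].
have /IH[n [w [[|b] [ns ww w0 wn]]]] : reach (scons z e) s i x by exists f.
  suff [a az] : exists a, edge (e a) z.
    exists n.+1, (scons (e a) w), a; split=> //.
    by apply: walk_scons => //; rewrite w0.
  by case: c ez => [|a|a b] //= => [az|[_ az _]]; exists a.
by exists n, w, b; split=> //=; lia.
Qed.

Fixpoint steps e s f : Prop :=
  if s is c :: s' then exists2 z, step e c z & steps (scons z e) s' f
  else f = e.

Lemma steps_pos e s f i : steps e s f -> f (size s + i) = e i.
Proof.
elim: s e i => [|c s IH] e i /= => [->//|[z _ /IH h]].
by have := h i.+1; rewrite addnS.
Qed.

Lemma steps_rng e s f x : steps e s f -> rng e x -> rng f x.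
Proof. by move=> /steps_pos h [i <-]; exists (size s + i). Qed.

Lemma steps_strong e s f : strong e -> steps e s f -> strong f.
Proof.
by elim: s e => [|c s IH] e se /= => [->//|[z /step_strong-/(_ HM se)/IH]].
Qed.

Lemma steps_cat e s f s' g : steps e s f -> steps f s' g -> steps e (s ++ s') g.
Proof.
elim: s e => [e -> //|c s IH] e /= [z ez r] /(IH _ r); by exists z.
Qed.

Definition captures e x : Prop := exists s f, steps e s f /\ rng f x.

(** A loose run is replaced by generic steps, one vertex at a time. Capturing neighbours is assumed
    only for runs that use [Nbr]: [edge_captures] is proved from the other runs, and then discharges
    the assumption. *)
Lemma run_captures e0 e s g i : run e0 s g -> strong e ->
  (forall i, rng e (e0 i)) ->
  (0 < count is_nbr s ->
    forall e a z, strong e -> edge (e a) z -> captures e z) ->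
  captures e (g i).
Proof.
elim: s e0 e => [|c s IH] e0 e /=.
  by move=> -> se ee _; exists [::], e.
move=> [z ez r] se ee hn.
have next s1 f : steps e s1 f -> rng f z -> captures e (g i).
  move=> st fz; have [|||s2 [f2 [st2 rf2]]] := IH _ f r.
  - exact: steps_strong st.
  - by move=> [|j] //=; apply: steps_rng st (ee j).
  - by move=> h; apply: hn; lia.
  - by exists (s1 ++ s2), f2; split=> //; apply: steps_cat st st2.
have [rz|nz] := pselect (rng e z); first by apply: (next [::] e).
case: c ez hn => [|a|a b] //= => [az|[ab az bz]] hn.
  have [a' ea] := ee a; rewrite -ea in az.
  by have [s1 [f [st rf]]] := hn isT e a' z se az; apply: next st rf.
have [a' ea] := ee a; have [b' eb] := ee b.
apply: (next [:: Apx a' b'] (scons z e)); last by exists 0.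
by exists z => //=; rewrite ea eb.
Qed.

Lemma edge_captures e a z : strong e -> edge (e a) z -> captures e z.
Proof.
move=> se az; have [fz|nf] := pselect (far e 1 z).
  exists [:: Nbr a], (scons z e); split; last by exists 0.
  by exists z.
have [s [i [cs [f r <-]]]] : exists s i, count is_nbr s = 0 /\ reach e s i z.
  apply: contrapT => n; apply: nf => s i cs r; apply: n; exists s, i.
  by split=> //; lia.
by apply: run_captures r se _ _ => [j|]; [exists j|rewrite cs].
Qed.

Lemma strong_captures e x : strong e -> captures e x.
Proof.
move=> se; have [[s [i [f r <-]]]|nr] := pselect (exists s i, reach e s i x).
  by apply: run_captures r se _ _ => [j|_]; [exists j|exact: edge_captures].
exists [:: Iso], (scons x e); split; last by exists 0.
by exists x => // s i r; apply: nr; exists s, i.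
Qed.

Hypothesis satM : saturated M.

(** Finitely many sequences without [Nbr] reach finitely many vertices, while [e a] has infinitely
    many neighbours. Saturation avoids all such sequences at once. *)
Lemma exists_step_nbr e a : exists z, step e (Nbr a) z.
Proof.
pose phi (o : option (seq instr * nat)) : form M :=
  if o is Some si then
    if count is_nbr si.1 == 0 then Neg (reach_from e si) else Top
  else Adj (Cst (e a)) (Var 0).
have [l|v hv] := satM (phi := phi).
  have fin : finite_set [set z | exists2 si, Some si \in l &
      count is_nbr si.1 = 0 /\ reach e si.1 si.2 z].
    elim: l => [|o l IH]; first by apply: sub_finite_set (finite_set0 M) => z [].
    case: o => [si|]; last first.
      by apply: sub_finite_set IH => z [si]; rewrite inE => /orP[//|sl h]; exists si.
    have [c0|c0] := eqVneq (count is_nbr si.1) 0; last first.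
      apply: sub_finite_set IH => z [s']; rewrite inE => /orP[/eqP[->] [h]|sl h].
        by rewrite h in c0.
      by exists s'.
    have := conj (finite_reach e si.2 c0) IH; rewrite -finite_setU.
    apply: sub_finite_set => z [s']; rewrite inE => /orP[/eqP[->] [_ h]|sl h].
      by left.
    by right; exists s'.
  have /infinite_setN0[z [az nz]] :=
    infinite_setD (@infinite_neighbours _ HM (e a)) fin.
  exists (fun=> z) => -[si|] // sl /=; case: eqP => [c0 /sat_reach_from h|_ //].
  by apply: nz; exists si.
exists (v 0); split; first exact: (hv None).
move=> s i cs r; have := hv (Some (s, i)); rewrite /= ifT; last by lia.
by case; apply/sat_reach_from.
Qed.

(** A generic neighbour of [f 0] is separated from [e] by [f 0], hence is
    farther from [e] than [f 0]. *)
Lemma exists_distant k e : strong e -> exists f, [/\ strong f,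
  forall b, rng f (e b) &
  forall n w b, walk n w -> w 0 = f 0 -> w n = e b -> k <= n].
Proof.
move=> se; elim: k => [|k [f [sf ef IH]]].
  by exists e; split=> // b; exists b.
have [z st] := exists_step_nbr f 0.
exists (scons z f); split; first exact: (step_strong HM sf st).
  by move=> b; have [i <-] := ef b; exists i.+1.
move=> n w b ww w0 wn.
(* The least such [m] is the first time the walk meets [f]. By [step_gate] it does so at [f 0],
   after at least one edge. *)
have exm : exists m, `[<rng f (w m)>] && (m <= n).
  by exists n; rewrite leqnn andbT wn; apply/asboolP.
have [m /andP[/asboolP[j fj] mn] mmin] := ex_minnP exm.
have m0 : 0 < m.
  by case: m {mn mmin} fj => // fj; case: (step_fresh st); exists j; rewrite fj w0.
have e0 : f j = f 0.
  apply: (step_gate HM sf st (n := m) (w := w)) => // [i im|i im ri].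
    by apply: ww; lia.
  have : m <= i by apply: mmin; rewrite (asboolT ri); lia.
  by lia.
have := IH (n - m) (fun i => w (i + m)) b; rewrite add0n -fj e0 subnK //.
move=> h; have : k <= n - m; last by lia.
by apply: h => //; apply: walk_shift; rewrite subnK.
Qed.

(** Finitely many sequences have bounded length, and a vertex at a larger distance is reached by
    none of them. Saturation does the rest. *)
Lemma exists_step_iso e : strong e -> exists z, step e Iso z.
Proof.
move=> se.
have [l|v hv] := satM (phi := fun si => Neg (reach_from e si)).
  have [k hk] : exists k, forall si : seq instr * nat, si \in l -> size si.1 < k.
    elim: l => [|si l [k hk]]; first by exists 0.
    exists (maxn (size si.1).+1 k) => sj.
    by rewrite inE leq_max => /orP[/eqP->|/hk ->]; rewrite ?leqnn ?orbT.
  have [f [sf ef far]] := exists_distant k se.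
  exists (fun=> f 0) => -[s i] /hk /= sk.
  move=> /sat_reach_from/reach_walk[n [w [b [ns ww w0 wn]]]].
  have := far n (fun i => w (n - i)) b; rewrite subn0 subnn.
  move=> /(_ (walk_rev HM ww) wn w0)/(leq_trans (leq_ltn_trans ns sk)).
  by rewrite ltnn.
exists (v 0) => s i r; have := hv (s, i); apply.
exact/sat_reach_from.
Qed.

End Extension.

Definition env_iso (M N : structure) (e : nat -> M) (e' : nat -> N) : Prop :=
  forall i j, (e i = e j <-> e' i = e' j) /\
              (edge (e i) (e j) <-> edge (e' i) (e' j)).

Definition similar (M N : structure) (e : nat -> M) (e' : nat -> N) : Prop :=
  [/\ strong e, strong e' & env_iso e e'].

Lemma similar_sym (M N : structure) (e : nat -> M) (e' : nat -> N) :
  similar e e' -> similar e' e.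
Proof.
by move=> [se se' ee]; split=> // i j; have [h1 h2] := ee i j; split;
  apply: iff_sym.
Qed.

Section BackAndForth.
Variables M N : structure.
Hypotheses (HM : model M farey_axioms) (HN : model N farey_axioms).
Implicit Types e f : nat -> M.

Lemma similar_scons e (e' : nat -> N) c z z' :
  similar e e' -> step e c z -> step e' c z' -> similar (scons z e) (scons z' e').
Proof.
move=> [se se' ee] st st'.
split; [exact: (step_strong HM) st|exact: (step_strong HN) st'|].
have ez l : edge z (e l) <-> edge z' (e' l).
  rewrite (step_edge HM l se st) (step_edge HN l se' st').
  by case: c {st st'} => [|a|a b] //; [|rewrite (ee l b).1]; rewrite (ee l a).1.
have nz l : (z = e l <-> z' = e' l).
  by split=> h; [case: (step_fresh st)|case: (step_fresh st')]; exists l.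
have ir := edge_irr HM; have ir' := edge_irr HN.
move=> [|i] [|j] //=; first by split; split=> // [/ir|/ir'].
  split; first by split=> /esym/nz.
  by split=> [/(edgeC HM)/ez/(edgeC HN)|/(edgeC HN)/ez/(edgeC HM)].
Qed.

Hypothesis satN : saturated N.

(** For an apex, one of the two apices of the image edge must be new: if both were in [e'], they
    would correspond to two apices in [e], and [z] would be a third. *)
Lemma step_transfer e (e' : nat -> N) c z : similar e e' -> step e c z ->
  exists z', step e' c z'.
Proof.
move=> [se se' ee]; case: c => [|a|a b] st.
- exact: exists_step_iso.
- exact: exists_step_nbr.
- case: st => ab az bz nz; have ab' := (ee a b).2.1 ab.
  have [z1 [z2 [z12 [a1 b1] [a2 b2] h]]] := two_apices HN ab'.
  have [[i iz1]|n1] := pselect (rng e' z1); last by exists z1.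
  have [[j jz2]|n2] := pselect (rng e' z2); last by exists z2.
  rewrite -iz1 -jz2 in z12 a1 b1 a2 b2.
  have z12' : e i <> e j by move=> /(ee i j).1.
  exfalso; apply: z12'; apply: (@no_three_apices _ HM (e a) (e b) z) => //.
  + exact/(ee a i).2.
  + exact/(ee b i).2.
  + exact/(ee a j).2.
  + exact/(ee b j).2.
  + by move=> zi; apply: nz; exists i.
  + by move=> zj; apply: nz; exists j.
Qed.

Lemma steps_similar e (e' : nat -> N) s f (f' : nat -> N) :
  similar e e' -> steps e s f -> steps e' s f' -> similar f f'.
Proof.
elim: s e e' => [|c s IH] e e' ee /=; first by move=> -> ->.
move=> [z st r] [z' st' r']; apply: IH r r'; exact: similar_scons st st'.
Qed.

Lemma steps_transfer e (e' : nat -> N) s f : similar e e' -> steps e s f ->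
  exists2 f' : nat -> N, steps e' s f' & similar f f'.
Proof.
elim: s e e' => [|c s IH] e e' ee /= => [->|[z st r]]; first by exists e'.
have [z' st'] := step_transfer ee st.
have [f' r' ff] := IH _ _ (similar_scons ee st st') r.
by exists f' => //; exists z'.
Qed.

Lemma forth e (e' : nat -> N) x : similar e e' ->
  exists f (f' : nat -> N), [/\ similar f f', rng f x &
  exists n, forall i, f (n + i) = e i /\ f' (n + i) = e' i].
Proof.
move=> ee; have [se _ _] := ee.
have [s [f [st rf]]] := strong_captures HM x se.
have [f' st' ff] := steps_transfer ee st.
exists f, f'; split=> //; exists (size s) => i.
by rewrite (steps_pos _ st) (steps_pos _ st').
Qed.

End BackAndForth.

Section Transfer.
Variables M N : structure.
Hypotheses (HM : model M farey_axioms) (HN : model N farey_axioms).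
Hypotheses (satM : saturated M) (satN : saturated N).

(** Induction on the formula. At a quantifier, the element chosen on either side is captured by
    extending both enumerations with [forth], the models being swapped for one of the directions. *)
Lemma sat_similar C (k : C -> M) (k' : C -> N) v v' p e e' : similar e e' ->
  {in fvars p, forall x, exists i, e i = v x /\ e' i = v' x} ->
  (forall c, form_cst p c -> exists i, e i = k c /\ e' i = k' c) ->
  sat k v p <-> sat k' v' p.
Proof.
have et (t : term C) (u : nat -> M) (u' : nat -> N) (f : nat -> M) f' :
    {in tvars t, forall x, exists i, f i = u x /\ f' i = u' x} ->
    (forall c, term_cst t c -> exists i, f i = k c /\ f' i = k' c) ->
    exists i, f i = eval k u t /\ f' i = eval k' u' t.
  by case: t => [x h _|c _ h] /=; [apply: h; rewrite inE|apply: h].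
have inl (s1 s2 : seq nat) x : x \in s1 -> x \in s1 ++ s2.
  by rewrite mem_cat => ->.
have inr (s1 s2 : seq nat) x : x \in s2 -> x \in s1 ++ s2.
  by rewrite mem_cat orbC => ->.
elim: p v v' e e' => [|s t|s t|p IHp q IHq|x p IHp] v v' e e' ee hv hk //=.
1,2: have [||i [es es']] := et s v v' e e';
      [by move=> x /inl/hv|by move=> c sc; apply: hk; left|];
     have [||j [<- <-]] := et t v v' e e';
      [by move=> x /inr/hv|by move=> c sc; apply: hk; right|];
     by rewrite -es -es'; case: ee => _ _ /(_ i j)[].
- rewrite (IHp v v' e e') 1?(IHq v v' e e') //.
  + by move=> x /inr/hv.
  + by move=> c sc; apply: hk; right.
  + by move=> x /inl/hv.
  + by move=> c sc; apply: hk; left.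
- have next f f' n a a' : similar f f' ->
      (forall i, f (n + i) = e i /\ f' (n + i) = e' i) ->
      (exists i, f i = a /\ f' i = a') ->
      sat k (upd v x a) p <-> sat k' (upd v' x a') p.
    move=> ff fe fa; apply: (IHp _ _ f f') => //.
      move=> y yp; rewrite /upd; case: eqVneq => // yx.
      have [|i [<- <-]] := hv y; first by rewrite mem_filter yx.
      by exists (n + i).
    by move=> c /hk[i [<- <-]]; exists (n + i).
  split=> [h a'|h a].
    have [f' [f [ff [i ia] [n fe]]]] := forth HN HM satM a' (similar_sym ee).
    apply/(next f f' n (f i)) => //.
    + exact: similar_sym.
    + by move=> j; have [] := fe j.
    + by exists i.
  have [f [f' [ff [i ia] [n fe]]]] := forth HM HN satN a ee.
  by apply/(next f f' n _ (f' i)) => //; exists i.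
Qed.

End Transfer.

(** * The upper bound on the rank *)

Definition fin_ord (k : nat) : ord := iter k OSucc OZero.

Section UpperBound.
Variable M : structure.
Hypothesis HM : model M farey_axioms.
Implicit Types (e f g h : nat -> M) (x y z : M) (s : seq instr).

Lemma strong_cst x : strong (fun=> x).
Proof. by move=> n w _ [i <-] [j <-] []. Qed.

(** The entries of [a] are captured one after another. The union of the stages is strong because the
    two ends of a walk already lie in a common stage. *)
Lemma strong_cover (a : nat -> M) : exists2 e, strong e & forall n, rng e (a n).
Proof.
have ext n e : exists f, strong e ->
    [/\ strong f, rng f (a n) & forall x, rng e x -> rng f x].
  have [se|ns] := pselect (strong e); last by exists e => /ns.
  have [s [f [st rf]]] := strong_captures HM (a n) se.
  exists f => _; split=> //; first exact: (steps_strong HM) st.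
  by move=> x; apply: steps_rng st.
have /choice[F HF] := fun ne : nat * (nat -> M) => ext ne.1 ne.2.
pose E := fix E n := if n is m.+1 then F (m, E m) else fun=> a 0.
have sE n : strong (E n).
  by elim: n => [|n /(HF (n, E n))[]//]; apply: strong_cst.
have mono n m x : n <= m -> rng (E n) x -> rng (E m) x.
  elim: m => [|m IH]; first by rewrite leqn0 => /eqP->.
  rewrite leq_eqVlt => /predU1P[->//|/IH h /h].
  by have [_ _] := HF (m, E m) (sE m); apply.
pose e i := if unpickle i is Some nj then E nj.1 nj.2 else E 0 0.
have eE n x : rng (E n) x -> rng e x.
  by move=> [j <-]; exists (pickle (n, j)); rewrite /e pickleK.
have Ee x : rng e x -> exists n, rng (E n) x.
  by move=> [i <-]; rewrite /e; case: unpickle => [nj|];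
    [exists nj.1, nj.2|exists 0, 0].
exists e => [n w ww /Ee[n1 r1] /Ee[n2 r2] d wi|n]; last first.
  by apply: (eE n.+1); have [] := HF (n, E n) (sE n).
apply: (sE (maxn n1 n2)) => //.
- by apply: mono r1; rewrite leq_maxl.
- by apply: mono r2; rewrite leq_maxr.
- by move=> i /wi ni /eE.
Qed.

Lemma far_follows g c z s x : follows g c z -> far g (count is_nbr (c :: s)) x ->
  far (scons z g) (count is_nbr s) x.
Proof.
move=> fz fx s1 i1 c1 [f r fi]; apply: (fx (c :: s1) i1); first by rewrite /=; lia.
by exists f => //; exists z.
Qed.

Lemma far_rename e e' (r : nat -> nat) k x : (forall i, e i = e' (r i)) ->
  far e' k x -> far e k x.
Proof.
move=> er fx s i cs /(reach_rename er)[s' [i' [h cs']]].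
by apply: (fx s' i') => //; rewrite cs'.
Qed.

Lemma similar_refl e : strong e -> similar e e.
Proof. by []. Qed.

(** [x] over [g] and [y] over [g0] have the same type. *)
Definition conjugate g0 g y x : Prop := exists h0 h n a,
  [/\ similar h0 h, forall j, h0 (n + j) = g0 j /\ h (n + j) = g j,
      h0 a = y & h a = x].

Hypothesis satM : saturated M.

Lemma conjugate_sat e y x p : conjugate e e y x ->
  (forall c, form_cst p c -> rng e c) -> in_vars 1 p ->
  sat id (fun=> y) p <-> sat id (fun=> x) p.
Proof.
move=> [h0 [h [n [a [hh ext <- <-]]]]] pe pv.
apply: (sat_similar HM HM satM satM hh) => [v _|c /pe[j <-]].
  by exists a.
by exists (n + j).
Qed.

(** A run has finitely many generic outcomes up to conjugacy: a neighbour which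
    is not generic is reached without [Nbr], so the outcome is not [far]. *)
Lemma finite_outcomes s g0 (r : nat -> nat) i : strong g0 ->
  exists2 L : set M, finite_set L & forall g x, similar g0 g ->
    reach (g \o r) s i x -> far g (count is_nbr s) x ->
    exists2 y, L y & conjugate g0 g y x.
Proof.
elim: s g0 r => [|c s IH] g0 r sg0.
  exists [set g0 (r i)]; first exact: finite_set1.
  move=> g x gg [f -> <-] _; exists (g0 (r i)) => //.
  by exists g0, g, 0, (r i).
(* The first vertex [z] of a run over [g] has a counterpart [z0] over [g0]: an old vertex at the
   same position, or a new one added by the same step. For a fixed [z0], induction bounds the
   outcomes of the rest of the run. *)
have next z0 : exists2 L : set M, finite_set L & forall g z x, similar g0 g ->
    (exists l, g0 l = z0 /\ g l = z) \/ (exists c, step g0 c z0 /\ step g c z) ->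
    reach (scons z (g \o r)) s i x -> far (scons z g) (count is_nbr s) x ->
    exists2 y, L y & conjugate g0 g y x.
  have [[l0 gl0]|nz0] := pselect (rng g0 z0).
    have [L fL hL] := IH g0 (scons l0 r) sg0.
    exists L => // g z x gg [[l [gl gz]]|[c' [/step_fresh st _]]]; last first.
      by case: st; exists l0.
    move=> rx fx; apply: hL => //.
      rewrite (_ : g \o _ = scons z (g \o r)) //.
      apply/funext => -[|j] //=; rewrite -gz.
      by case: gg => _ _ /(_ l0 l)[[<- //]]; rewrite gl0 gl.
    by apply: (far_rename (r := S) _ fx).
  have [[c' st0]|nst] := pselect (exists c', step g0 c' z0); last first.
    exists set0; first exact: finite_set0.
    move=> g z x gg [[l [gl _]]|[c' [st _]]] _ _.
      by case: nz0; exists l.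
    by case: nst; exists c'.
  have [L fL hL] := IH (scons z0 g0) (scons 0 (S \o r)) (step_strong HM sg0 st0).
  exists L => // g z x gg [[l [gl _]]|[c2 [st1 st2]]] rx fx.
    by case: nz0; exists l.
  have [||//|y Ly [h0 [h [n [a [hh ext h0a ha]]]]]] := hL (scons z g) x.
  - exact: (similar_scons HM HM gg st1 st2).
  - by rewrite (_ : _ \o _ = scons z (g \o r)) //; apply/funext => -[|j].
  exists y => //; exists h0, h, n.+1, a; split=> // j.
  by have := ext j.+1; rewrite addnS.
case: c => [|a|a b].
- exists set0; first exact: finite_set0.
  by move=> g x _ [f []].
- have [z0 st0] := exists_step_nbr HM satM g0 (r a).
  have [L fL hL] := next z0; exists L => // g x gg [f [z gz rf] fi] fx.
  have [fz|nf] := pselect (far g 1 z).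
    apply: (hL g z x gg) => //.
    + by right; exists (Nbr (r a)).
    + by exists f.
    + exact: (@far_follows g (Nbr (r a))).
  case: nf => s1 i1 cs1 [f1 r1 fz].
  (* After the run [s1], which has no [Nbr], the neighbour [z] sits at position [i1] and the old
     entries have moved up by [size s1]. *)
  have [||s2 [i2 [r2 cs2]]] := @reach_rename _ (scons z (g \o r)) f1 s i x
      (scons i1 (fun j => size s1 + r j)).
  + by move=> [|j] //=; rewrite (run_pos _ r1).
  + by exists f.
  apply: (fx (s1 ++ s2) i2); first by rewrite count_cat cs2 /=; lia.
  exact: reach_after r1 r2.
- have [ab|nab] := pselect (edge (g0 (r a)) (g0 (r b))); last first.
    exists set0; first exact: finite_set0.
    move=> g x [_ _ /(_ (r a) (r b))[_ h]] [f [z [/h]]] //.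
  have [z1 [z2 [_ _ _ ap]]] := two_apices HM ab.
  have [L1 fL1 hL1] := next z1; have [L2 fL2 hL2] := next z2.
  exists (L1 `|` L2); first by rewrite finite_setU.
  move=> g x gg [f [z gz rf] fi] fx.
  have {}fx := @far_follows g (Apx (r a) (r b)) z s x gz fx.
  have rx : reach (scons z (g \o r)) s i x by exists f.
  suff [z0 [z0a z0b tw]] : exists z0, [/\ edge (g0 (r a)) z0, edge (g0 (r b)) z0 &
      (exists l, g0 l = z0 /\ g l = z) \/ (exists c, step g0 c z0 /\ step g c z)].
    have [e|e] := ap z0 z0a z0b; rewrite e in tw.
      by have [y Ly h] := hL1 g z x gg tw rx fx; exists y => //; left.
    by have [y Ly h] := hL2 g z x gg tw rx fx; exists y => //; right.
  case: gz => _ az bz.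
  have [[l gl]|nz] := pselect (rng g z).
    exists (g0 l); case: gg => _ _ gg; split; last by left; exists l.
      by apply/(gg _ _).2; rewrite gl.
    by apply/(gg _ _).2; rewrite gl.
  have st : step g (Apx (r a) (r b)) z.
    by split=> //; case: gg => _ _ gg; apply/(gg _ _).2.
  have [z0 st0] := step_transfer HM HM satM (similar_sym gg) st.
  by exists z0; case: (st0) => _ ? ? _; split=> //; right; exists (Apx (r a) (r b)).
Qed.

Lemma sat_in_vars1 (v : nat -> M) p : in_vars 1 p ->
  sat id v p <-> sat id (fun=> v 0) p.
Proof.
by move=> /allP pv; apply: sat_eq => x /pv; rewrite ltnS leqn0 => /eqP->.
Qed.

(** Compactness: if no finite list of the sequences in [b] covers [p], then any finitely many of
    them are avoided by some vertex of [p], hence all of them are. *)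
Lemma avoid_or_cover e p (b : pred (seq instr * nat)) : in_vars 1 p ->
  (exists2 x, sat id (fun=> x) p & forall si, b si -> ~ reach e si.1 si.2 x) \/
  (exists l : seq (seq instr * nat), forall x, sat id (fun=> x) p ->
     exists si, [/\ si \in l, b si & reach e si.1 si.2 x]).
Proof.
move=> pv; have [|/forallNP nc] := pselect (exists l : seq (seq instr * nat),
  forall x, sat id (fun=> x) p ->
  exists si, [/\ si \in l, b si & reach e si.1 si.2 x]); first by right.
left; pose phi (o : option (seq instr * nat)) : form M :=
  if o is Some si then if b si then Neg (reach_from e si) else Top else p.
have [l|v hv] := satM (phi := phi).
  have /existsNP[x /not_implyP[px nx]] := nc (pmap id l).
  exists (fun=> x) => -[si|] // sl /=; case: ifP => [bs|_ //].
  move=> /sat_reach_from r; apply: nx; exists si; split=> //.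
  by rewrite mem_pmap map_id.
have vp : sat id v p := hv None.
exists (v 0); first exact: (sat_in_vars1 v pv).1 vp.
move=> si bs /sat_reach_from r; have := hv (Some si).
by rewrite /= bs; apply.
Qed.

Lemma pigeonhole (f : nat -> M) (L : set M) : finite_set L ->
  (forall n, L (f n)) -> exists i j, i <> j /\ f i = f j.
Proof.
move=> fL Lf; apply: contrapT => n; apply: infinite_nat.
rewrite (_ : setT = f @^-1` L); last by apply/predeqP => n'; split=> // _; exact: Lf.
apply: finite_preimage fL => i j _ _ fij.
by apply: contrapT => ij; apply: n; exists i, j.
Qed.

Lemma form_cst_enum (p : form M) x0 :
  exists c : nat -> M, forall x, form_cst p x -> rng c x.
Proof.
have /finite_seqP[s ->] : finite_set (form_cst p : set {classic M}).
  exact: finite_form_cst.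
exists (nth (x0 : {classic M}) s) => x /= /(nthP (x0 : {classic M}))[i _ <-].
by exists i.
Qed.

Lemma strong_cover_forms e (q : nat -> form M) : exists e', [/\ strong e',
  forall i, rng e' (e i) & forall n c, form_cst (q n) c -> rng e' c].
Proof.
have /choice[c hc] := fun n => form_cst_enum (q n) (e 0).
pose a i := match unpickle i : option (nat + nat * nat) with
  | Some (inl j) => e j | Some (inr (n, j)) => c n j | None => e 0 end.
have [e' se' ea] := strong_cover a; exists e'; split=> //.
  by move=> j; have := ea (pickle (inl j : nat + nat * nat)); rewrite /a pickleK.
move=> n x /hc[j <-].
by have := ea (pickle (inr (n, j) : nat + nat * nat)); rewrite /a pickleK.
Qed.

(** Otherwise finitely many sequences with at most [k] uses of [Nbr] cover [p]. Each of the disjoint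
    [q n] contains a vertex that is far over a strong set [e'] holding all parameters. These
    vertices fall into finitely many conjugacy classes, and two in one class satisfy the same
    formulas over [e'], against disjointness. *)
Lemma rank_far k p e : strong e -> in_vars 1 p ->
  (forall c, form_cst p c -> rng e c) -> rank_ge 1 (fin_ord k) p ->
  exists2 x, sat id (fun=> x) p & far e k x.
Proof.
elim: k p e => [|k IH] p e se pv pe /=.
  by move=> [v /(sat_in_vars1 _ pv) vp]; exists (v 0).
move=> [q [qr qp qd]].
have [[x px nx]|[l cov]] := @avoid_or_cover e p
    (fun si => count is_nbr si.1 <= k) pv.
  by exists x => // s i ck; apply: (nx (s, i)).
exfalso; have [e' [se' /choice[r er] qe']] := strong_cover_forms e q.
have {}er j : e j = e' (r j) by rewrite er.
have /choice[x hx] n : exists x, sat id (fun=> x) (q n) /\ far e' k x.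
  by have [qv rq] := qr n; have [x qx fx] := IH (q n) e' se' qv (qe' n) rq; exists x.
have outcomes (l' : seq (seq instr * nat)) : exists2 L : set M, finite_set L &
    forall y si, si \in l' -> reach e si.1 si.2 y ->
    far e' (count is_nbr si.1) y -> exists2 z, L z & conjugate e' e' z y.
  elim: l' => [|si l' [L fL hL]].
    by exists set0; [exact: finite_set0|].
  have [L' fL' hL'] := finite_outcomes si.1 r si.2 se'.
  exists (L' `|` L); first by rewrite finite_setU.
  move=> y sj; rewrite inE => /orP[/eqP-> ry fy|sl ry fy].
    have [|z Lz h] := hL' e' y (similar_refl se') _ fy.
      by rewrite (_ : _ \o _ = e) //; apply/funext => j /=.
    by exists z => //; left.
  by have [z Lz h] := hL y sj sl ry fy; exists z => //; right.
have [L fL hL] := outcomes l.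
have /choice[z hz] n : exists z, L z /\ conjugate e' e' z (x n).
  have [qx fx] := hx n.
  have [|si [sl ck rs]] := cov (x n); first exact: qp qx.
  have [|z Lz h] := hL (x n) si sl rs; last by exists z.
  by move=> s i ci; apply: fx; apply: leq_trans ci ck.
have [i [j [ij zij]]] := pigeonhole fL (fun n => (hz n).1).
have [qiv _] := qr i.
apply: (qd i j (fun=> x j) ij); split; last by case: (hx j).
apply/(conjugate_sat (hz j).2 (qe' i) qiv); rewrite -zij.
by apply/(conjugate_sat (hz i).2 (qe' i) qiv); case: (hx i).
Qed.

(** A finite cover of [p] by sequences would bound the number of uses of [Nbr], against
    [rank_far]. *)
Lemma generic_of_rank_omega p e : strong e -> in_vars 1 p ->
  (forall c, form_cst p c -> rng e c) -> rank_ge 1 ord_omega p ->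
  exists2 x, sat id (fun=> x) p & step e Iso x.
Proof.
move=> se pv pe rp; have [[x px nx]|[l cov]] := @avoid_or_cover e p xpredT pv.
  by exists x => // s i; apply: (nx (s, i)).
have [k hk] : exists k, forall si : seq instr * nat, si \in l ->
    count is_nbr si.1 < k.
  elim: l {cov} => [|si l [k hk]]; first by exists 0.
  exists (maxn (count is_nbr si.1).+1 k) => sj.
  by rewrite inE leq_max => /orP[/eqP->|/hk ->]; rewrite ?leqnn ?orbT.
have [x px fx] := rank_far se pv pe (rp k).
by have [[s i] [sl _ r]] := cov x px; case: (fx s i (hk _ sl)).
Qed.

Lemma rank_le_omega (p : form M) : ~ rank_ge 1 (OSucc ord_omega) p.
Proof.
move=> [q [qr _ qd]].
have [x0] := structure_nonempty M.
have [e [se _ qe]] := strong_cover_forms (fun=> x0) q.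
have [qv0 r0] := qr 0; have [qv1 r1] := qr 1.
have [x qx sx] := generic_of_rank_omega se qv0 (qe 0) r0.
have [y qy sy] := generic_of_rank_omega se qv1 (qe 1) r1.
apply: (qd 0 1 (fun=> x)) => //; split=> //.
apply/(@conjugate_sat e y x) => //; last exact: (qe 1).
(* Both vertices arise from [e] by one [Iso] step, so they have the same type over it. *)
exists (scons y e), (scons x e), 1, 0; split=> //.
exact: (similar_scons HM HM (similar_refl se) sy sx).
Qed.

End UpperBound.

(** * The lower bound on the rank *)

Section Elementary.
Variables (M N : structure) (j : M -> N).
Hypothesis jE : forall C (k : C -> M) v q, sat (j \o k) (j \o v) q <-> sat k v q.

(** Elementarity speaks only of assignments into the image of [j], so the free variables of [p] are
    first bound by [Alls n]. *)
Lemma valid_map (p : form M) : (forall v, sat id v p) ->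
  forall v, sat id v (map_form j p).
Proof.
move=> pM v; have [x0] := structure_nonempty M.
pose n := (\max_(x <- fvars p) x).+1.
have fn x : x \in fvars p -> x < n.
  by move=> xp; rewrite ltnS (big_rem x) //= leq_maxl.
have /jE/sat_Alls h : sat id (fun=> x0) (Alls n p) by apply/sat_Alls.
pose v' x := if x < n then v x else j x0.
have v'p : sat (id \o j) v' p by apply: h => x nx; rewrite /v' ltnNge nx.
rewrite sat_map; apply/(@sat_eq _ _ _ v v' p) => // x /fn xn.
by rewrite /v' xn.
Qed.

(** Rank does not drop in an elementary extension, so an upper bound found in an ultrapower holds in
    the original model. *)
Lemma rank_ge_map n a (p : form M) : rank_ge n a p -> rank_ge n a (map_form j p).
Proof.
elim: a p => [|a IH|f IH] p /=.
- by move=> [v vp]; exists (j \o v); rewrite sat_map; apply/(jE id).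
- move=> [q [qr qp qd]]; exists (fun i => map_form j (q i)); split.
  + move=> i; have [qv rq] := qr i.
    by rewrite /in_vars fvars_map; split=> //; exact: IH.
  + by move=> i v; have := @valid_map (Imp (q i) p) (qp i) v.
  + move=> i l v il [qi ql].
    have := @valid_map (Imp (q i) (Neg (q l))) _ v; apply=> // w h1 h2.
    by apply: (qd i l w).
- by move=> h i; apply: IH.
Qed.

End Elementary.

Lemma rank_ge_sub (M : structure) n a (p p' : form M) :
  (forall v, sat id v p -> sat id v p') -> rank_ge n a p -> rank_ge n a p'.
Proof.
move=> pp; elim: a => [|a IH|f IH] /=.
- by move=> [v /pp h]; exists v.
- by move=> [q [qr qp qd]]; exists q; split=> // i v /qp/pp.
- by move=> h i; apply: IH.
Qed.

Lemma infinite_seq T (A : set T) : infinite_set A ->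
  exists f : nat -> T, (forall n, A (f n)) /\ injective f.
Proof.
move=> /infiniteP/card_leP/unsquash f.
exists (fun n => \val (f (to_setT n))); split=> [n|n m /val_inj h].
  exact: set_valP.
have := 'inj_f (in_setT (to_setT n)) (in_setT (to_setT m)) h.
by move=> /(congr1 \val).
Qed.

(** * Walks with wide turns *)

Section LowerBound.
Variable M : structure.
Hypothesis HM : model M farey_axioms.
Implicit Types (x y z b c d : M) (w : nat -> M).

(** For neighbours [x] and [z] of [y]: their distance in the link of [y], the graph on its
    neighbours, is at least three. *)
Definition wide x y z : Prop :=
  [/\ x <> z, ~ edge x z & forall t, edge t x -> edge t y -> ~ edge t z].

Lemma wideC x y z : wide x y z -> wide z y x.
Proof.
move=> [xz exz nt]; split; first exact: nesym.
  by move=> /(edgeC HM).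
by move=> t tz ty tx; apply: (nt t).
Qed.

(** A shortest closed subwalk is a cycle. Its ears are narrow, hence at [t] only;
    but removing the ear at [t] leaves no ear. *)
Lemma wide_open n t w : 0 < n -> walk n w ->
  (forall i, 0 < i < n -> i <> t -> wide (w i.-1) (w i) (w i.+1)) ->
  (0 < t < n -> w t.-1 <> w t.+1) -> w 0 <> w n.
Proof.
elim/ltn_ind: n t w => n IH t w n0 ww wi wt cl.
have sw : simple n.-1 w.
  suff h i k : i < k <= n.-1 -> w i <> w k.
    move=> i k hi hk e; have [ik|ik|//] := ltngtP i k.
      by case: (h i k) => //; lia.
    by case: (h k i) => //; lia.
  (* A repetition gives a shorter closed subwalk. If [t] comes before it, the truncated [t - i] is
     0, which is no interior index. *)
  move=> ik; have := IH (k - i) _ (t - i) (fun l => w (l + i)).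
  rewrite add0n subnK; last by lia.
  apply; try by lia.
  - by apply: walk_shift => l lk; apply: ww; lia.
  - move=> l lk lt; have := wi (l + i); rewrite addSn.
    by rewrite (_ : (l + i).-1 = l.-1 + i); [apply|]; lia.
  - move=> tk; have := wt; rewrite addSn subnK; last by lia.
    by rewrite (_ : (t - i).-1 + i = t.-1); [apply|]; lia.
have {}wi i : 0 < i < n -> i <> t ->
    wide (w i.-1) (w i) (w i.+1) /\ ~ edge (w i.-1) (w i.+1).
  by move=> h1 h2; have h := wi i h1 h2; split=> //; case: h.
have [n1|n1] := eqVneq n 1.
  by apply: (edge_neq HM _ cl); rewrite n1; apply: ww; lia.
have [n2|n2] := eqVneq n 2.
  have [t1|t1] := eqVneq t 1; first by apply: (wt ltac:(lia)); rewrite t1 /= cl n2.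
  by have [[h _ _] _] := wi 1 ltac:(lia) ltac:(lia); apply: h; rewrite cl n2.
have e0 : edge (w 0) (w n.-1).
  apply: (edgeC HM); rewrite cl -[in w n](prednK n0); apply: ww; lia.
have ww1 : walk n.-1 w by move=> i ni; apply: ww; lia.
have [l ln el] := ear HM ww1 sw ltac:(lia) e0.
have {l el ln} [tn et] : 0 < t < n.-1 /\ edge (w t.-1) (w t.+1).
  have [<-//|lt] := eqVneq l t.
  by have [_ []] := wi l ltac:(lia) ltac:(lia).
have [n3|n3] := eqVneq n 3.
  have [_ []] := wi 2 ltac:(lia) ltac:(lia).
  have -> : w 3 = w 0 by rewrite cl n3.
  by apply: (edgeC HM); apply: ww; lia.
have n2E : n.-2.+1 = n.-1 by lia.
have [||||l ln] := @ear _ HM n.-2 (skip t w).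
- by apply: walk_skip => //; rewrite ?n2E //; lia.
- by apply: simple_skip; rewrite n2E.
- by lia.
- by rewrite skip_lt ?skip_ge ?n2E //; lia.
(* An ear away from the removed vertex was an ear before. If the ear is next to it, a wide turn at
   [t.+1] or [t.-1] has [w t.-1] or [w t.+1], respectively, as a forbidden common neighbour. *)
have [lt|tl|lt] := ltngtP l.+1 t.
- rewrite (@skip_lt _ _ _ l.-1) ?(@skip_lt _ _ _ l.+1); try lia.
  by have [_ h] := wi l ltac:(lia) ltac:(lia).
- have [lt|lt] := eqVneq l t.
    rewrite (@skip_lt _ _ _ l.-1) ?(@skip_ge _ _ _ l.+1); try lia.
    move=> e; have [[_ _ h] _] := wi l.+1 ltac:(lia) ltac:(lia).
    apply: (h (w l.-1)) => //; last by rewrite lt.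
    by have := ww l.-1; rewrite prednK; [apply|]; lia.
  rewrite (@skip_ge _ _ _ l.-1) ?(@skip_ge _ _ _ l.+1); try lia.
  by have [_] := wi l.+1 ltac:(lia) ltac:(lia); rewrite prednK //; lia.
- rewrite (@skip_lt _ _ _ l.-1) ?(@skip_ge _ _ _ l.+1); try lia.
  move=> e; have [[_ _ h] _] := wi l ltac:(lia) ltac:(lia).
  apply: (h (w l.+2)); [exact: (edgeC HM)| |]; apply: (edgeC HM).
    by move: et; rewrite -lt.
  by apply: ww; lia.
Qed.

Fixpoint chain k b c x : Prop :=
  if k is k'.+1 then exists d, [/\ edge c d, wide b c d & chain k' c d x]
  else x = c.

Lemma chain_walk k b c x : edge b c -> chain k b c x -> exists w,
  [/\ walk k.+1 w, w 0 = b, w 1 = c, w k.+1 = x &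
      forall i, 0 < i < k.+1 -> wide (w i.-1) (w i) (w i.+1)].
Proof.
elim: k b c => [|k IH] b c bc /=.
  by move=> ->; exists (scons b (fun=> c)); split=> // [[|]|[|]].
move=> [d [cd bcd /(IH _ _ cd)[w [ww w0 w1 wk wi]]]].
exists (scons b w); split=> //.
- by apply: walk_scons => //; rewrite w0.
- by move=> [|[|i]] //= ik; [rewrite w0 w1|apply: (wi i.+1)].
Qed.

(** One walk backwards followed by the other is a closed walk [u]. Its turns are wide except at [b],
    in the middle, where it does not turn back because [c] and [c'] differ. This contradicts
    [wide_open]. *)
Lemma chain_disjoint k b c c' x : edge b c -> edge b c' -> c <> c' ->
  chain k b c x -> chain k b c' x -> False.
Proof.
move=> bc bc' cc /(chain_walk bc)[w [ww w0 w1 wk wi]].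
move=> /(chain_walk bc')[w' [ww' w0' w1' wk' wi']].
pose u i := if i <= k.+1 then w (k.+1 - i) else w' (i - k.+1).
have ul i : i <= k.+1 -> u i = w (k.+1 - i) by rewrite /u => ->.
have ur i : k.+1 <= i -> u i = w' (i - k.+1).
  rewrite leq_eqVlt /u => /predU1P[<-|ki]; last by rewrite ifN // -ltnNge.
  by rewrite leqnn subnn w0 w0'.
apply: (@wide_open (k.+1 + k.+1) k.+1 u) => //.
- move=> i ik; have [h|h] := leqP i.+1 k.+1.
    rewrite !ul; try lia.
    apply: (edgeC HM); rewrite (_ : k.+1 - i = (k.+1 - i.+1).+1); last by lia.
    by apply: ww; lia.
  rewrite !ur; try lia.
  by rewrite subSn; [apply: ww'|]; lia.
- move=> i ik it; have [h|h] := leqP i.+1 k.+1.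
    rewrite !ul; try lia.
    have := wi (k.+1 - i) ltac:(lia) => /wideC.
    rewrite (_ : (k.+1 - i).+1 = k.+1 - i.-1); last by lia.
    by rewrite (_ : (k.+1 - i).-1 = k.+1 - i.+1) //; lia.
  rewrite !ur; try lia.
  have := wi' (i - k.+1) ltac:(lia).
  rewrite (_ : (i - k.+1).-1 = i.-1 - k.+1); last by lia.
  by rewrite (_ : (i - k.+1).+1 = i.+1 - k.+1) //; lia.
- move=> _ /=; rewrite (ul k) // (ur k.+2) // subSnn.
  by rewrite (_ : k.+2 - k.+1 = 1) ?w1 ?w1' //; lia.
- by rewrite (ul 0) // ur ?leq_addr // subn0 addnK wk wk'.
Qed.

Section ChainFormula.
Variable C : Type.
Implicit Types r s t : term C.

Definition wide_form r s t m : form C :=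
  And (Neg (Eq r t)) (And (Neg (Adj r t))
    (All m (Imp (Adj (Var m) r) (Imp (Adj (Var m) s) (Neg (Adj (Var m) t)))))).

Fixpoint chain_form k r s m : form C :=
  if k is k'.+1 then
    Ex m (And (Adj s (Var m))
              (And (wide_form r s (Var m) m.+1) (chain_form k' s (Var m) m.+1)))
  else Eq (Var 0) s.

Lemma fvars_chain k r s m : 0 < m -> fresh m r -> fresh m s ->
  in_vars m (chain_form k r s m).
Proof.
elim: k r s m => [|k IH] r s m m0 fr fs.
  by rewrite /in_vars /= m0.
have wk n t : fresh n t -> fresh n.+1 t by apply: sub_all => i; lia.
have fm : fresh m.+1 (Var m : term C) by rewrite /fresh /= ltnSn.
have fm1 : fresh m.+2 (Var m.+1 : term C) by rewrite /fresh /= ltnSn.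
rewrite [chain_form _ _ _ _]/=; apply: in_vars_Ex; rewrite /wide_form !in_varsA.
rewrite (IH s (Var m) m.+1 isT (wk _ s fs) fm) !in_varsN !in_vars_Adj in_vars_Eq.
rewrite in_vars_All ?in_varsI ?in_varsN ?in_vars_Adj; first by rewrite fm !wk.
by rewrite fm1 (wk _ _ fm) !(wk m.+1) ?wk.
Qed.

End ChainFormula.

Lemma finite_apices x y : edge x y -> finite_set [set z | edge x z /\ edge y z].
Proof.
move=> /(two_apices HM)[z1 [z2 [_ _ _ h]]].
apply: sub_finite_set (finite_set2 z1 z2) => z [xz yz].
by case: (h z xz yz) => ->; [left|right].
Qed.

(** Only finitely many neighbours of [c] are excluded: [b], the apices of the edge from [b] to [c],
    and the apices of the edges from these to [c]. *)
Lemma infinite_wide b c : edge b c ->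
  infinite_set [set d | edge c d /\ wide b c d].
Proof.
move=> bc; have cb := edgeC HM bc.
have [z1 [z2 [_ [bz1 cz1] [bz2 cz2] h]]] := two_apices HM bc.
pose B := [set b] `|` [set d | edge b d /\ edge c d] `|`
  ([set d | edge z1 d /\ edge c d] `|` [set d | edge z2 d /\ edge c d]).
have fB : finite_set B.
  rewrite !finite_setU; do !split; first exact: finite_set1.
  - exact: finite_apices.
  - exact/finite_apices/(edgeC HM).
  - exact/finite_apices/(edgeC HM).
apply: sub_infinite_set (infinite_setD (infinite_neighbours HM (v := c)) fB).
move=> d [/= cd nB]; split=> //; split.
- by move=> bd; apply: nB; left; left.
- by move=> bd; apply: nB; left; right.
- move=> t /(edgeC HM) bt /(edgeC HM) ct td.
  by case: (h t bt ct) => e; apply: nB; right; [left|right]; rewrite -e.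
Qed.

Lemma sat_chain C (k : C -> M) v n r s m : 0 < m -> fresh m r -> fresh m s ->
  sat k v (chain_form n r s m) <-> chain n (eval k v r) (eval k v s) (v 0).
Proof.
elim: n r s v m => [//|n IH] r s v m m0 fr fs.
have ev l a t u : m <= l -> fresh m t -> eval k (upd u l a) t = eval k u t.
  case: t => [x|//] ml; rewrite /fresh /= andbT => xm.
  by rewrite /upd; case: eqP => //; lia.
have um u a : upd u m a m = a by rewrite /upd eqxx.
have um1 u a : upd u m.+1 a m.+1 = a by rewrite /upd eqxx.
have evm u a : eval k (upd u m a) (Var m) = a by apply: um.
have v0 d : upd v m d 0 = v 0 by rewrite /upd ifF //; lia.
have ws d : sat k (upd v m d) (wide_form r s (Var m) m.+1) <->
    wide (eval k v r) (eval k v s) d.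
  have nm a : upd (upd v m d) m.+1 a m = d by rewrite {1}/upd ifF ?um //; lia.
  rewrite !satA !satN /= um ev //.
  split=> [[h1 [h2 h3]]|[h1 h2 h3]].
    split=> // t; have := h3 t; rewrite um1 nm !ev //; try lia.
  split=> //; split=> // t; have := h3 t; rewrite um1 nm !ev //; try lia.
rewrite [chain_form _ _ _ _]/= satE.
have fsm : fresh m.+1 s by apply: sub_all fs => y; lia.
have fm : fresh m.+1 (Var m : term C) by rewrite /fresh /= ltnSn.
split=> [[d /satA[sd /satA[/ws wd]]]|[d [cd wd ch]]].
  rewrite IH // evm ev // v0 => h; exists d; split=> //.
  by have : edge (eval k (upd v m d) s) (eval k (upd v m d) (Var m)) := sd;
    rewrite evm ev.
exists d; apply/satA; split.
  suff : edge (eval k (upd v m d) s) (eval k (upd v m d) (Var m)) by [].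
  by rewrite evm ev.
apply/satA; split; first exact/ws.
by rewrite IH // evm ev // v0.
Qed.

(** The infinitely many wide continuations of the edge give disjoint subsets, each of rank one less
    by induction. *)
Lemma rank_chain k b c : edge b c ->
  rank_ge 1 (fin_ord k) (chain_form k (Cst b) (Cst c) 1).
Proof.
elim: k b c => [|k IH] b c bc /=; first by exists (fun=> c).
have [d [dD dI]] := infinite_seq (infinite_wide bc).
exists (fun i => chain_form k (Cst c) (Cst (d i)) 1); split.
- move=> i; have [cd _] := dD i; split; [exact: fvars_chain|exact: IH].
- move=> i v /sat_chain-/(_ isT isT isT) /= ch.
  suff : sat id v (chain_form k.+1 (Cst b) (Cst c) 1) by [].
  apply/sat_chain => //=; exists (d i).
  by have [] := dD i.
- move=> i j v ij [/sat_chain-/(_ isT isT isT) /= ci].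
  move=> /sat_chain-/(_ isT isT isT) /=.
  apply: chain_disjoint ci; [by have [] := dD i|by have [] := dD j|].
  by move=> /dI.
Qed.

Lemma rank_ge_omega : rank_ge 1 ord_omega (Eq (Var 0) (Var 0) : form M).
Proof.
have [_ iso _ _] := (model_farey_axioms M).1 HM.
have [b] := structure_nonempty M; have [c bc] := iso b.
by move=> k; apply: rank_ge_sub (rank_chain k bc).
Qed.

End LowerBound.

(** * The Farey graph is a model *)

Section FareyGraph.
Implicit Types u v w x y z : vertex.

Let b i : vertex := Base (inord i).
Let bl n : seq (vertex * vertex) := blue (farey_level n).

Lemma base_inj i j : i < 4 -> j < 4 -> b i = b j -> i = j.
Proof. by move=> i4 j4 [/(congr1 val)]; rewrite /= !inordK. Qed.

(** The level at which a vertex appears, shifted so that the ends of the black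
    edge of level 1 come first. *)
Fixpoint height v : nat :=
  match v with
  | Base i => 1 < i
  | Apex u w => (maxn (height u) (height w)).+1
  end.

Lemma height_base i : i < 4 -> height (b i) = (1 < i).
Proof. by move=> i4; rewrite /= inordK. Qed.

Lemma mem_blue0 x w : ((x, w) \in bl 0) =
  ((x == b 0) || (x == b 1)) && ((w == b 2) || (w == b 3)).
Proof.
rewrite !inE !xpair_eqE.
by do 4 case: eqP => //= _.
Qed.

Lemma mem_blueS n x w : (x, w) \in bl n.+1 <->
  exists u v, [/\ (u, v) \in bl n, w = Apex u v & x = u \/ x = v].
Proof.
split=> [/flattenP[_ /mapP[[u v] uv ->]]|[u [v [uv -> xuv]]]].
  rewrite !inE !xpair_eqE /= => /orP[] /andP[/eqP-> /eqP->]; exists u, v.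
    by split=> //; left.
  by split=> //; right.
apply/flattenP; exists [:: (u, Apex u v); (v, Apex u v)].
  by apply/mapP; exists (u, v).
by rewrite !inE !xpair_eqE eqxx !andbT; case: xuv => ->; rewrite eqxx ?orbT.
Qed.

(** Edges as listed: every edge but the black one of level 1 was once blue, and has its younger end
    second. *)
Definition oriented x y : Prop :=
  (x = b 0 /\ y = b 1) \/ exists n, (x, y) \in bl n.

Lemma mem_all_edges n x y : (x, y) \in all_edges (farey_level n) <->
  (x = b 0 /\ y = b 1) \/ exists2 m, m <= n & (x, y) \in bl m.
Proof.
elim: n => [|n IH].
  rewrite /all_edges mem_cat /= inE xpair_eqE; split.
    move=> /orP[/andP[/eqP-> /eqP->]|h]; first by left.
    by right; exists 0.
  move=> [[-> ->]|[[|//] _ h]]; first by rewrite !eqxx.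
  by rewrite h orbT.
rewrite /all_edges mem_cat [black _]/=; split.
  move=> /orP[/IH[h|[m mn h]]|h]; [by left|right..].
    by exists m => //; lia.
  by exists n.+1.
move=> [h|[m mn h]]; first by rewrite (IH.2 (or_introl h)).
have [mE|mE] := eqVneq m n.+1; first by rewrite -/(bl _) -mE h orbT.
by rewrite IH.2 //; right; exists m => //; lia.
Qed.

Lemma height_blue n x w : (x, w) \in bl n -> height w = n.+1 /\ height x <= n.
Proof.
elim: n x w => [|n IH] x w.
  by rewrite mem_blue0 => /andP[/orP[]/eqP-> /orP[]/eqP->];
    rewrite !height_base.
move=> /mem_blueS[u [v [/IH[hv hu] -> xuv]]] /=.
by rewrite hv; split; [lia|case: xuv => ->; lia].
Qed.

(** The height of [w] fixes the level at which edges into it are blue. Beyond level 1 its name fixes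
    the ends; at level 1 they are [b 0] and [b 1]. *)
Lemma blue_parents n x w : (x, w) \in bl n -> exists u v,
  [/\ oriented u v, (u, w) \in bl n, (v, w) \in bl n &
      forall m y, (y, w) \in bl m -> y = u \/ y = v].
Proof.
move=> xw; have [hw _] := height_blue xw.
have lvl m y : (y, w) \in bl m -> m = n.
  by move=> /height_blue[]; rewrite hw => -[].
case: n xw {hw} lvl => [|n] xw lvl.
  exists (b 0), (b 1); split; first by left.
  - by move: xw; rewrite !mem_blue0 eqxx => /andP[_ ->].
  - by move: xw; rewrite !mem_blue0 eqxx orbT => /andP[_ ->].
  - move=> m y h; move: (h); rewrite (lvl _ _ h) mem_blue0.
    by move=> /andP[/orP[]/eqP-> _]; [left|right].
have /mem_blueS[u [v [uv wE _]]] := xw; exists u, v; split.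
- by right; exists n.
- by apply/mem_blueS; exists u, v; split=> //; left.
- by apply/mem_blueS; exists u, v; split=> //; right.
- move=> m y h; have := h; rewrite (lvl _ _ h) => /mem_blueS[u' [v' [_]]].
  by rewrite wE => -[<- <-].
Qed.

Lemma oriented_height x y : oriented x y ->
  [/\ x = b 0, y = b 1, height x = 0 & height y = 0] \/
  (height x < height y /\ exists n, (x, y) \in bl n).
Proof.
move=> [[-> ->]|[n h]]; first by left; rewrite !height_base.
by right; have [-> xn] := height_blue h; split; [lia|exists n].
Qed.

Definition adjacent x y : Prop := oriented x y \/ oriented y x.

Lemma adjacentC x y : adjacent x y -> adjacent y x.
Proof. by case; [right|left]. Qed.

Lemma oriented_irr x : ~ oriented x x.
Proof.
move=> /oriented_height[[-> e _ _]|[]]; last by rewrite ltnn.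
by case: (@base_inj 0 1 isT isT e).
Qed.

(** The first black edge has the apices [b 2] and [b 3]. The apices of any other edge are the second
    parent of its younger end [y] and the vertex added for it: a common neighbour younger than [y]
    is named after this edge, and an older one is a parent of [y]. *)
Lemma oriented_triangles x y : oriented x y -> exists z1 z2,
  [/\ z1 <> z2, adjacent x z1 /\ adjacent y z1, adjacent x z2 /\ adjacent y z2 &
      forall z, adjacent x z -> adjacent y z -> z = z1 \/ z = z2].
Proof.
move=> xy; have irr z : ~ adjacent z z by case; apply: oriented_irr.
case: (oriented_height xy) => [[-> -> _ _]|[hxy [n bxy]]].
  have kid i j : i < 2 -> 1 < j < 4 -> adjacent (b i) (b j).
    move=> i2 j4; left; right; exists 0; rewrite mem_blue0.
    by case: i i2 => [|[|//]] _; case: j j4 => [|[|[|[|]]]] //; rewrite !eqxx ?orbT.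
  have up i z : i < 2 -> adjacent (b i) z ->
      [\/ z = b 0, z = b 1 | exists n, (b i, z) \in bl n].
    move=> i2 [[[_ ->]|[n h]]|[[-> _]|[n /height_blue[]]]].
    - exact: Or32.
    - by apply: Or33; exists n.
    - exact: Or31.
    - by rewrite height_base; case: i i2 => [|[]].
  exists (b 2), (b 3).
  split; [by move=> /(@base_inj 2 3 isT isT)|by split; exact: kid..|].
  move=> z a0 a1.
  have blue_z i : i < 2 -> adjacent (b i) z -> exists n, (b i, z) \in bl n.
    move=> i2 /(up _ _ i2)[zE|zE|//]; first by case: (irr z); rewrite {1}zE.
    by case: (irr z); rewrite {1}zE.
  have [n h0] := blue_z 0 isT a0; have [m h1] := blue_z 1 isT a1.
  have mn : m = n by case: (height_blue h0) (height_blue h1) => -> _ [[]].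
  rewrite {}mn in h1; case: n h0 h1 => [|n].
    by rewrite mem_blue0 => /andP[_ /orP[]/eqP->] _; [left|right].
  move=> /mem_blueS[u [v [uv -> h0]]] /mem_blueS[u' [v' [_ [<- <-] h1]]].
  have [hv _] := height_blue uv.
  have ne i : i < 2 -> b i <> v.
    by move=> i2 e; move: hv; rewrite -e height_base //; case: i i2 {e} => [|[]].
  case: h0 => [e0|/ne]; last by case.
  case: h1 => [e1|/ne]; last by case.
  by have := @base_inj 0 1 isT isT; rewrite e0 e1 => /(_ erefl).
have [hy hx] := height_blue bxy.
have [p [q [pq py qy par]]] := blue_parents bxy.
have [o [oy xo po]] : exists o, [/\ (o, y) \in bl n, adjacent x o &
    forall m z, (z, y) \in bl m -> z = x \/ z = o].
  case: (par _ _ bxy) => xE.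
    by exists q; split; rewrite ?xE //; left.
  exists p; split; rewrite ?xE //; first by right.
  by move=> m z /par[]->; [right|left].
have [_ ho] := height_blue oy.
exists o, (Apex x y); split.
- by move=> e; move: ho; rewrite e /= hy; lia.
- by split=> //; right; right; exists n.
- split; left; right; exists n.+1; apply/mem_blueS; exists x, y.
    by split=> //; left.
  by split=> //; right.
move=> z xz [[[yE _]|[m yz]]|[[_ yE]|[m zy]]].
- by move: hy; rewrite yE height_base.
- have [hz hym] := height_blue yz.
  case: m yz hz hym => [|m] yz hz hym; first by rewrite hy in hym.
  case: xz => [[[_ zE]|[l xz]]|/oriented_height[[zE _ _ _]|[]]]; last first.
  + by rewrite hz; lia.
  + by move: hz; rewrite zE height_base.
  + have [hz' _] := height_blue xz.
    have lm : l = m.+1 by move: hz'; rewrite hz => -[].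
    rewrite {}lm in xz.
    have [u [v [uv zE yuv]]] := (mem_blueS _ _ _).1 yz.
    have [u' [v' [_ zE' xuv]]] := (mem_blueS _ _ _).1 xz.
    move: zE'; rewrite zE => -[uE vE]; rewrite -{}uE -{}vE in xuv.
    have [hv hu] := height_blue uv; right.
    case: yuv => yE; case: xuv => xE.
    * by move: hx; rewrite xE -yE hy ltnn.
    * by move: hx hu; rewrite xE hv -yE hy; lia.
    * by rewrite xE yE.
    * by move: hx; rewrite xE -yE hy ltnn.
  + by move: hz; rewrite zE height_base.
- by move: hy; rewrite yE height_base.
- by case: (po _ _ zy) => zE; [case: (irr x); rewrite -{2}zE|left].
Qed.

Lemma orientedE x y :
  oriented x y <-> exists n, (x, y) \in all_edges (farey_level n).
Proof.
split=> [[h|[n h]]|[n /mem_all_edges[h|[m _ h]]]].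
- by exists 0; apply/mem_all_edges; left.
- by exists n; apply/mem_all_edges; right; exists n.
- by left.
- by right; exists m.
Qed.

Lemma farey_edgeE (u w : farey_vertex) :
  farey_edge u w <-> adjacent (sval u) (sval w).
Proof.
split=> [[n [h|h]]|[/orientedE[n h]|/orientedE[n h]]].
- by left; apply/orientedE; exists n.
- by right; apply/orientedE; exists n.
- by exists n; left.
- by exists n; right.
Qed.

Lemma adjacent_vertex x y : adjacent x y -> exists n, y \in vertices (farey_level n).
Proof.
move=> [] /orientedE[n h]; exists n; rewrite mem_cat.
  by apply/orP; right; apply/mapP; exists (x, y).
by apply/orP; left; apply/mapP; exists (y, x).
Qed.

Lemma farey_vertex_inj (u w : farey_vertex) : sval u = sval w -> u = w.
Proof. by case: u w => [u hu] [w hw] /= ?; apply: eq_exist. Qed.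

Lemma farey_simple : simple_graph farey_graph.
Proof.
split=> [u|u w] /farey_edgeE; first by case; apply: oriented_irr.
by move=> /adjacentC h; apply/farey_edgeE.
Qed.

Lemma farey_no_isolated : no_isolated_vertex farey_graph.
Proof.
move=> [u hu]; have [n un] := hu.
suff [w uw] : exists w, adjacent u w.
  by exists (exist _ w (adjacent_vertex uw)); apply/farey_edgeE.
move: un; rewrite mem_cat => /orP[] /mapP[[x y] xy /= ->].
  by exists y; left; apply/orientedE; exists n.
by exists x; right; apply/orientedE; exists n.
Qed.

Lemma farey_two_triangles : edges_in_two_triangles farey_graph.
Proof.
move=> u w /farey_edgeE uw.
have [z1 [z2 [z12 [uz1 wz1] [uz2 wz2] h]]] : exists z1 z2,
    [/\ z1 <> z2, adjacent (sval u) z1 /\ adjacent (sval w) z1,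
        adjacent (sval u) z2 /\ adjacent (sval w) z2 &
    forall z, adjacent (sval u) z -> adjacent (sval w) z -> z = z1 \/ z = z2].
  case: uw => /oriented_triangles[z1 [z2 [z12 [a1 b1] [a2 b2] h]]];
    by exists z1, z2; split=> // z a b'; apply: h.
exists (exist _ z1 (adjacent_vertex uz1)), (exist _ z2 (adjacent_vertex uz2)).
split=> [[]//|]; apply/predeqP => z; split=> /=.
  by move=> [/farey_edgeE uz /farey_edgeE wz]; case: (h _ uz wz) => zE;
    [left|right]; apply: farey_vertex_inj.
by case=> ->; split; apply/farey_edgeE.
Qed.

Lemma exists_highest (A : set farey_vertex) (u : farey_vertex) :
  finite_set A -> A u -> exists2 w : farey_vertex, A w &
  forall x : farey_vertex, A x -> height (sval x) <= height (sval w).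
Proof.
move=> fA Au.
have [N bd] : exists N, forall x : farey_vertex, A x -> height (sval x) <= N.
  have /finite_seqP[s sA] := finite_image (fun x : farey_vertex => height (sval x)) fA.
  exists (\max_(i <- s) i) => x Ax.
  have xs : height (sval x) \in s.
    by have : [set` s] (height (sval x)) by rewrite -sA; exists x.
  by rewrite (big_rem _ xs) /= leq_maxl.
pose P n := `[< exists2 x : farey_vertex, A x & height (sval x) = n >].
have exP : exists n, P n by exists (height (sval u)); apply/asboolP; exists u.
have bdP n : P n -> n <= N by move=> /asboolP[x /bd + <-].
case: (ex_maxnP exP bdP) => m /asboolP[w Aw wm] mx; exists w => // x Ax.
by rewrite wm; apply: mx; apply/asboolP; exists x.
Qed.

(** The neighbours of a highest vertex are its parents, which are adjacent. *)
Lemma farey_removable : finite_subgraphs_removable farey_graph.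
Proof.
move=> A fA [u Au]; have [w Aw wmax] := exists_highest fA Au.
exists w => //.
have [|] := pselect (forall y z : farey_graph,
  neighbours A w y -> neighbours A w z -> y = z).
  by left.
move=> /existsNP[y /existsNP[z /not_implyP[[Ay wy] /not_implyP[[Az wz] yz]]]].
right; exists y, z.
(* The ends of the first black edge both have height 0, so a highest vertex may also be one of them;
   it then has at most one neighbour in [A], the other end. *)
have low (x : farey_vertex) : A x -> farey_edge w x ->
    (sval w = b 0 /\ sval x = b 1) \/ (sval w = b 1 /\ sval x = b 0) \/
    exists n, (sval x, sval w) \in bl n.
  move=> /wmax hx /farey_edgeE[/oriented_height[[wE xE _ _]|[]]|[[xE wE]|]].
  - by left.
  - by move=> h; have := leq_trans h hx; rewrite ltnn.
  - by right; left.
  - by right; right.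
have b01 : b 0 <> b 1 by move=> /(@base_inj 0 1 isT isT).
have par : exists p q, oriented p q /\ forall x : farey_vertex, A x -> farey_edge w x ->
    sval x = p \/ sval x = q.
  have hb i n (x : vertex) : i < 2 -> sval w = b i -> (x, sval w) \notin bl n.
    move=> i2 wE; apply/negP => /height_blue[].
    by rewrite wE height_base //; case: i i2 {wE} => [|[]].
  case: (low y Ay wy) => [[wE yE]|[[wE yE]|[n yw]]].
  - case: yz; apply: farey_vertex_inj; rewrite yE.
    case: (low z Az wz) => [[_ ->//]|[[wE' _]|[n]]].
      by case: b01; rewrite -wE.
    by rewrite (negbTE (hb 0 n _ _ _)).
  - case: yz; apply: farey_vertex_inj; rewrite yE.
    case: (low z Az wz) => [[wE' _]|[[_ ->//]|[n]]].
      by case: b01; rewrite -wE.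
    by rewrite (negbTE (hb 1 n _ _ _)).
  have [p [q [pq _ _ pr]]] := blue_parents yw; exists p, q; split=> // x Ax wx.
  case: (low x Ax wx) => [[wE _]|[[wE _]|[m /pr//]]].
    by rewrite (negbTE (hb 0 n _ _ _)) in yw.
  by rewrite (negbTE (hb 1 n _ _ _)) in yw.
have [p [q [pq pr]]] := par.
have yz' : sval y <> sval z by move=> /farey_vertex_inj.
have ayz : adjacent (sval y) (sval z).
  by case: (pr y Ay wy) (pr z Az wz) yz' => -> [] -> // _; [left|right].
split=> //; last exact/farey_edgeE.
apply/predeqP => x; split=> [[Ax wx]|[->|->]//].
case: (pr x Ax wx) (pr y Ay wy) (pr z Az wz) yz' => xE [] yE [] zE;
  rewrite yE zE => // _.
- by left; apply: farey_vertex_inj; rewrite xE yE.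
- by right; apply: farey_vertex_inj; rewrite xE zE.
- by right; apply: farey_vertex_inj; rewrite xE zE.
- by left; apply: farey_vertex_inj; rewrite xE yE.
Qed.

Lemma farey_model : model farey_graph farey_axioms.
Proof.
apply/model_farey_axioms; split.
- exact: farey_simple.
- exact: farey_no_isolated.
- exact: farey_two_triangles.
- exact: farey_removable.
Qed.

End FareyGraph.

(** * Completeness, stability and rank *)

Lemma sentence_farey_axioms p : farey_axioms p -> sentence p.
Proof.
case=> [[[[->|->]|->]|->]|[n _ <-]] //.
have v i : i < n.+1 -> fresh n.+1 (Var i : term void) by rewrite /fresh /= andbT.
apply: in_vars_Alls; rewrite in_varsI; apply/andP; split.
  apply: in_vars_bigA => i _; apply: in_vars_bigA => j _.
  by rewrite in_varsN in_vars_Eq !v //; have := ltn_ord i; have := ltn_ord j; lia.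
apply: in_vars_bigO => i; rewrite in_varsO; apply/andP; split.
  apply: in_vars_bigA => j _; apply: in_vars_bigA => k _.
  rewrite in_varsN in_varsA !in_vars_Adj !v //.
  by have := ltn_ord j; have := ltn_ord k; lia.
apply: in_vars_bigO => j; apply: in_vars_bigO => k.
have kn : k < n.+1 by have := ltn_ord j; have := ltn_ord k; lia.
rewrite !in_varsA !in_vars_Adj !v //=.
by apply: in_vars_bigA => l _; rewrite in_varsN in_vars_Adj !v.
Qed.

Section ElementaryExtension.
Variables (M N : structure) (j : M -> N).
Hypothesis jE : forall C (k : C -> M) v q, sat (j \o k) (j \o v) q <-> sat k v q.

Lemma sat_sentence (L : structure) C (k : C -> L) p v v' :
  in_vars 0 p -> sat k v p <-> sat k v' p.
Proof. by move=> /allP p0; apply: sat_eq => x /p0. Qed.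

Lemma holds_extension p : sentence p -> holds M p <-> holds N p.
Proof.
move=> sp; have [x0] := structure_nonempty M.
have kE : j \o @of_void M = @of_void N by apply/funext => -[].
split=> h v.
  by apply/(sat_sentence _ (j \o fun=> x0) _ sp); rewrite -kE; apply/jE/h.
by apply/jE; rewrite kE; apply: h.
Qed.

Lemma model_extension : model M farey_axioms -> model N farey_axioms.
Proof.
move=> HM p hp; apply/holds_extension; [exact: sentence_farey_axioms|exact: HM].
Qed.

End ElementaryExtension.

Lemma farey_complete (M N : structure) p : model M farey_axioms ->
  model N farey_axioms -> sentence p -> holds M p -> holds N p.
Proof.
move=> HM HN sp hp.
have [M' [j [satM jE]]] := saturated_extension M.
have [N' [l [satN lE]]] := saturated_extension N.
have HM' := model_extension jE HM; have HN' := model_extension lE HN.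
apply/(holds_extension lE sp) => v; have [x] := structure_nonempty M'.
(* Constant enumerations are strong and isomorphic, and a sentence has no free variables or
   constants to match. *)
have ee : similar (fun=> x) (fun=> v 0).
  split; [exact: strong_cst|exact: strong_cst|move=> _ _; split=> //].
  by split=> /edge_neq; [move=> /(_ HM')|move=> /(_ HN')].
have p0 y : y \in fvars p -> False by move=> /(allP sp).
apply/(sat_similar (k := @of_void M') HM' HN' satM satN (v := fun=> x) ee).
- by move=> y /p0.
- by case.
- by move/(holds_extension jE sp): hp; apply.
Qed.

Lemma model_Th_farey M : model M (Th farey_graph) -> model M farey_axioms.
Proof.
move=> HM p hp; apply: HM; split; first exact: sentence_farey_axioms.
exact: farey_model.
Qed.

(** The family given to [saturated] is indexed by trees: a tree coding a formula of [p] stands for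
    it, and every other tree for [Top]. *)
Lemma saturated_realises (N : structure) C (g : C -> nat) (k : C -> N)
    (p : set (form C)) : saturated N -> injective g ->
  (forall q, finite_set q -> q `<=` p -> exists v, forall f, q f -> sat k v f) ->
  exists v, forall f, p f -> sat k v f.
Proof.
move=> satN gI fs; pose enc := enc_form g; have encI := enc_form_inj gI.
have /choice[phi hphi] (t : GenTree.tree nat) : exists f : form N,
    (forall h, p h -> enc h = t -> f = map_form k h) /\
    ((forall h, p h -> enc h <> t) -> f = Top).
  have [[h [ph ht]]|n] := pselect (exists h, p h /\ enc h = t).
    exists (map_form k h); split=> [h' _ e|/(_ h ph)//].
    by congr map_form; apply: encI (etrans ht (esym e)).
  by exists Top; split=> // h ph ht; case: n; exists h.
have [s|v hv] := satN _ phi; last first.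
  exists v => f pf; have := hv (enc f).
  by rewrite ((hphi _).1 f pf erefl) sat_map.
have [|f [_ pf]|v hv] := fs [set f | enc f \in s /\ p f].
- apply: sub_finite_set (finite_preimage (B := [set` s]) (f := enc) _ _).
  + by move=> f [].
  + by move=> f h _ _ /encI.
  + by apply/finite_seqP; exists s.
- by [].
exists v => t ts; have [[h [ph ht]]|n] := pselect (exists h, p h /\ enc h = t).
  rewrite ((hphi t).1 h ph ht) sat_map; apply: hv.
  by split=> //; rewrite ht.
by rewrite (hphi t).2 // => h ph ht; apply: n; exists h.
Qed.

Lemma saturated_omega (N : structure) : saturated N -> omega_saturated N.
Proof.
move=> satN A n p fA [_ fs _].
have /countable_injP[g gI] := finite_set_countable fA.
apply: (saturated_realises (g := g \o sval)) => //.
move=> [a Aa] [b Ab] /= gab; apply: eq_exist.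
by apply: gI gab; apply/mem_set.
Qed.

(** * Counting types *)

Section TypeCodes.
Variables (M N : structure) (j : M -> N).
Hypothesis jE : forall C (k : C -> M) v q, sat (j \o k) (j \o v) q <-> sat k v q.
Hypotheses (HN : model N farey_axioms) (satN : saturated N).
Variables (A : set M) (n : nat).
Hypothesis cA : countable A.

Lemma captures_tuple (e v : nat -> N) m : strong e -> exists s f r,
  steps e s f /\ forall x, x < m -> f (nth 0 r x) = v x.
Proof.
move=> se; elim: m => [|m [s [f [r [st fr]]]]].
  by exists [::], e, [::].
have sf := steps_strong HN se st.
have [s' [g [st' [a gv]]]] := strong_captures HN (v m) sf.
(* New vertices enter at the front, so the positions found earlier move up by [size s']. *)
exists (s ++ s'), g, (mkseq (fun x => if x < m then size s' + nth 0 r x else a) m.+1).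
split; first exact: steps_cat st st'.
move=> x xm; rewrite nth_mkseq //; case: ifPn => [/fr <-|].
  exact: (steps_pos _ st').
by rewrite -leqNgt => mx; have -> : x = m by lia.
Qed.

Lemma countable_types : countable [set p | @complete_type M A n p].
Proof.
have [x0] := structure_nonempty N.
have /countable_injP[g gI] := cA.
have [a aA] : exists a : nat -> N, forall c, A c -> rng a (j c).
  have /choice[a ha] i : exists y, forall c, A c -> g c = i -> y = j c.
    have [[c [Ac gc]]|nc] := pselect (exists c, A c /\ g c = i).
      exists (j c) => d Ad gd; congr j; apply: gI; rewrite ?gc ?gd //; exact/mem_set.
    by exists x0 => c Ac gc; case: nc; exists c.
  by exists a => c Ac; exists (g c); apply: ha.
have [e se ea] := strong_cover HN a.
have eA c : A c -> rng e (j c) by move=> /aA[i <-].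
(* A code consists of the steps that extend [e] to contain a realisation, and of the positions of
   the realisation. Two realisations with one code lie in similar extensions, hence have the same
   type over [A]. *)
pose codes (p : set (form {a | A a})) (c : seq instr * seq nat) :=
  exists v f, [/\ forall q, p q -> sat (j \o sval) v q, steps e c.1 f &
                  forall x, x < n -> f (nth 0 c.2 x) = v x].
have code p : complete_type n p -> exists c, codes p c.
  move=> [pv fs _].
  have [||v hv] := @saturated_realises N _ (g \o sval) (j \o sval) p satN _ _.
  - move=> [b Ab] [c Ac] /= gbc; apply: eq_exist.
    by apply: gI gbc; apply/mem_set.
  - move=> q fq qp; have [v hv] := fs q fq qp.
    by exists (j \o v) => f /hv; apply: (jE _ _ _).2.
  have [s [f [r [st fr]]]] := captures_tuple v n se.
  by exists (s, r), v, f.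
have code_sub p p' c : complete_type n p -> complete_type n p' ->
    codes p c -> codes p' c -> p `<=` p'.
  move=> [pv _ _] [_ _ pc'] [v [f [pq st fr]]] [v' [f' [pq' st' fr']]] q hq.
  have qv := pv q hq; have [//|/pq'] := pc' q qv; case.
  have ff := steps_similar HN HN (similar_refl se) st st'.
  have vq : sat (j \o sval) v' q.
    suff vv' : sat (j \o sval) v q <-> sat (j \o sval) v' q by exact/vv'/pq.
    apply: (sat_similar HN HN satN satN ff).
    - by move=> x /(allP qv)/= xn; exists (nth 0 c.2 x); rewrite fr ?fr'.
    - move=> [b Ab] _ /=; have [i <-] := eA b Ab.
      exists (size c.1 + i).
      by rewrite (steps_pos _ st) (steps_pos _ st').
  exact: vq.
have /choice[F hF] p : exists c, complete_type n p -> codes p c.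
  have [/code[c hc]|np] := pselect (complete_type n p); first by exists c.
  by exists ([::], [::]) => /np.
apply/countable_injP; exists (fun p => pickle (F p)) => p p' /set_mem tp /set_mem tp'.
move=> /(pcan_inj pickleK) FF; have cp := hF p tp; have cp' := hF p' tp'.
rewrite -FF in cp'; apply/seteqP; split; first exact: code_sub cp cp'.
exact: code_sub cp' cp.
Qed.

End TypeCodes.

Theorem theorem1p1 :
  axiomatizes farey_axioms (Th farey_graph) /\
  omega_stable (Th farey_graph) /\
  has_morley_rank (Th farey_graph) ord_omega.
Proof.
split; [split|split; [|split]].
- exact: sentence_farey_axioms.
- move=> p sp; split=> [[_ hp] M HM|h].
    exact: farey_complete farey_model HM sp hp.
  by split=> //; apply: h; apply: farey_model.
- move=> M /model_Th_farey HM A n cA.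
  have [N [j [satN jE]]] := saturated_extension M.
  exact: (countable_types jE (model_extension jE HM) satN).
- have [N [j [satN jE]]] := saturated_extension farey_graph.
  exists N; split; last exact: saturated_omega.
  by move=> p [sp hp]; apply/(holds_extension jE sp).
- move=> M /model_Th_farey HM _; split; first exact: rank_ge_omega.
  (* The upper bound was proved under countable saturation, so it is applied in an extension, where
     the rank is at least as large. *)
  have [N [j [satN jE]]] := saturated_extension M.
  move=> /(rank_ge_map jE).
  exact: (rank_le_omega (model_extension jE HM) satN).
Qed.
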